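(* Let $\xi$ be a non-negative integer-valued random variable with $\mathbb{E}\xi=1$ and $0<\mathrm{Var}(\xi)<\infty$, let $\mathcal{T}$ be the Galton-Watson tree with offspring distribution $\xi$, and let $\mathcal{T}_n$ be $\mathcal{T}$ conditioned on $|\mathcal{T}|=n$. Assume that $\xi$ has an $f$-super-exponential tail (as defined in the context), and let $f^{-1}$ denote the inverse of $f$. Let $\mathcal{S}^+_{\le k}$ be the set of plane trees $T$ with $|T|\le k$ and $\mathbb{P}(\mathcal{T}=T)>0$, and let $k_n$ be a sequence of positive integers. Then for all constants $\delta>0$: (1) if $k_n\le f^{-1}((1-\delta)\log n)+1$, then with high probability $\mathcal{T}_n$ contains all trees in $\mathcal{S}^+_{\le k_n}$ as fringe subtrees; (2) if $k_n\ge f^{-1}((1+\delta)\log n)+1$, then with high probability $\mathcal{T}_n$ does not contain all trees in $\mathcal{S}^+_{\le k_n}$ as fringe subtrees. Therefore, with $K_n:=\max\{k:\text{every tree in }\mathcal{S}^+_{\le k}\text{ is a fringe subtree of }\mathcal{T}_n\}$, $$\frac{K_n}{f^{-1}(\log n)}\to1\quad\text{in probability.}$$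
   Context: A plane tree is a finite rooted, ordered, unlabeled tree; $|T|$ is its number of nodes. For a node $v$ of $T$, the fringe subtree $T_v$ consists of $v$ and all its descendants; $T$ contains $T'$ as a fringe subtree if $T_v$ is isomorphic (as a plane tree) to $T'$ for some $v$. The Galton-Watson tree is generated from the root by giving each node independently a number of children distributed as $\xi$. Let $p_i=\mathbb{P}(\xi=i)$. One says that $\xi$ has an $f$-super-exponential tail if $\inf\{p_0(p_i/p_0)^{1/i}:i\ge1,\ p_i>0\}=0$, $p_i>0$ for all $i\ge0$, and $\log(1/p_i)\sim f(i)$ as $i\to\infty$ for a function $f:[0,\infty)\to[0,\infty)$ with $f(i)/i\uparrow\infty$ (that is, $f(i)/i$ is increasing with limit $\infty$). Limits are as $n\to\infty$. ''With high probability'' means with probability tending to $1$ as $n\to\infty$. *)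

(* Defs.v *)
From HB Require Import structures.
From mathcomp Require Import all_boot all_order all_algebra finmap.
From mathcomp Require Import all_classical all_reals all_analysis.
Import Order.TTheory GRing.Theory Num.Theory.
Import numFieldNormedType.Exports.

Set Implicit Arguments.
Unset Strict Implicit.
Unset Printing Implicit Defensive.

Local Open Scope classical_set_scope.
Local Open Scope ring_scope.

Inductive plane_tree : Type := Node of seq plane_tree.

Lemma plane_tree_nested_ind (Q : plane_tree -> Prop) :
  (forall s : seq plane_tree,
     (forall i, (i < size s)%N -> Q (nth (Node [::]) s i)) -> Q (Node s)) ->
  forall t, Q t.
Proof.
move=> QN; fix rec 1 => -[s]; apply: QN.
elim: s => [|t s IHs] i; first by clear rec; rewrite ltn0.
by case: i => [_|i]; [exact: rec | exact: IHs].
Qed.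

Fixpoint plane_tree_encode (t : plane_tree) : GenTree.tree unit :=
  let: Node s := t in GenTree.Node 0 (map plane_tree_encode s).

Fixpoint plane_tree_decode (t : GenTree.tree unit) : plane_tree :=
  match t with
  | GenTree.Leaf _ => Node [::]
  | GenTree.Node _ s => Node (map plane_tree_decode s)
  end.

Lemma plane_tree_encodeK : cancel plane_tree_encode plane_tree_decode.
Proof.
elim/plane_tree_nested_ind => s IHs /=; congr Node; rewrite -map_comp.
apply: (@eq_from_nth _ (Node [::])); rewrite size_map // => i si.
by rewrite (nth_map (Node [::])) //=; exact: IHs.
Qed.

HB.instance Definition _ := Countable.copy plane_tree
  (can_type plane_tree_encodeK).

Fixpoint tree_size (t : plane_tree) : nat :=
  let: Node s := t in (sumn (map tree_size s)).+1.

(* The list of all T_v, v ranging over the nodes of T in depth-first order.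
   Isomorphism of plane trees is equality in plane_tree, so "T contains T' as
   a fringe subtree" is T' \in fringe_subtrees T. *)
Fixpoint fringe_subtrees (t : plane_tree) : seq plane_tree :=
  let: Node s := t in Node s :: flatten (map fringe_subtrees s).

(* Nodes are Ulam-Harris words: the empty word is the root and rcons v i is the
   (i+1)-st child of v. Given a number x v of children for every word v,
   [generates x t] says that the tree grown from the root is finite and equal
   to t. An infinite tree is not equal to any t. *)
Inductive generates : (seq nat -> nat) -> plane_tree -> Prop :=
  Generates x s of x [::] = size s
    & (forall i, (i < size s)%N ->
         generates (fun v => x (i :: v)) (nth (Node [::]) s i))
    : generates x (Node s).

Section probability.
Context {R : realType}.

Definition mutually_independent {d d'} {Omega : measurableType d}
    {T : measurableType d'} (P : probability Omega R) (I : choiceType)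
    (X : I -> {RV P >-> T}) : Prop :=
  forall (J : {fset I}) (B : I -> set T), (forall i, measurable (B i)) ->
    P (\bigcap_(i in [set` J]) (X i @^-1` B i)) =
    (\prod_(i <- J) P (X i @^-1` B i))%E.

Definition nat_pmf {d} {Omega : measurableType d} (P : probability Omega R)
    (X : {RV P >-> nat}) (i : nat) : R := fine (P (X @^-1` [set i])).

Definition iid_copies {d d0} {Omega : measurableType d}
    {Omega0 : measurableType d0} (P : probability Omega R)
    (P0 : probability Omega0 R) (I : choiceType) (X : I -> {RV P >-> nat})
    (xi : {RV P0 >-> nat}) : Prop :=
  mutually_independent X /\ forall u i, nat_pmf (X u) i = nat_pmf xi i.

Section galton_watson.
Context {d} {Omega : measurableType d} {P : probability Omega R}.
Variable X : seq nat -> {RV P >-> nat}.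

Definition gw_event (A : set plane_tree) : set Omega :=
  [set w | exists2 t, A t & generates (fun v => X v w) t].

(* P(calT_n \in A), that is, P(calT \in A | |calT| = n). *)
Definition cond_gw_prob (n : nat) (A : set plane_tree) : R :=
  fine (P (gw_event (A `&` [set t | tree_size t = n])))
  / fine (P (gw_event [set t | tree_size t = n])).

(* The set S^+_{<= k}. *)
Definition small_trees (k : nat) : set plane_tree :=
  [set t | (tree_size t <= k)%N /\ (0 < P (gw_event [set t]))%E].

Definition contains_all (k : nat) : set plane_tree :=
  [set t | forall t', small_trees k t' -> t' \in fringe_subtrees t].

(* The maximum of { k | t \in contains_all k }, and 0 if there is none. *)
Definition max_containment (t : plane_tree) : nat :=
  xget 0%N [set k | contains_all k t /\
                    forall j, contains_all j t -> (j <= k)%N].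

End galton_watson.

(* The function f is only relevant on [0, +oo[. *)
Definition super_exponential_tail (f : R -> R) (p : nat -> R) : Prop :=
  [/\ inf [set p 0%N * (p i / p 0%N) `^ (i%:R^-1)
            | i in [set i | (1 <= i)%N /\ 0 < p i]] = 0,
      forall i, 0 < p i,
      (fun i : nat => ln (p i)^-1 : R^o) ~_\oo (fun i : nat => f i%:R : R^o),
      forall x : R, 0 <= x -> 0 <= f x
    & (forall x y : R, 0 < x -> x <= y -> f x / x <= f y / y) /\
      f x / x @[x --> +oo] --> +oo].

(* The inverse of f : [0, +oo[ -> [0, +oo[, extended by 0 to negative reals. *)
Definition nonneg_inverse (f : R -> R) : R -> R := 'pinv_(fun=> 0) `[0, +oo[ f.

End probability.

(* Main.v *)
Require Import Defs.
From HB Require Import structures.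
From mathcomp Require Import all_boot all_order all_algebra.
From mathcomp Require Import all_classical all_reals all_analysis.
From mathcomp Require finmap.
From mathcomp Require Import measurable_realfun zify lra ring.
Import Order.TTheory GRing.Theory Num.Theory.
Import numFieldNormedType.Exports.

(** Why the theorem is true.

    Write W t for the product of the offspring probabilities over the nodes
    of t, and a n for the sum of W over the trees of size n. The conditioned
    tree of size n has law W / a n, so each claim compares finite sums over the
    trees of size n (cond_gw_probE). The argument never looks at the random
    walk that codes the tree; it rests on one remark. In the recursion that
    splits a tree at its root, the trees of a fixed size k enter only through
    their total weight. Hence, if the weights of two trees T and T' of size k
    are multiplied by factors lam and mu that preserve lam * W T + mu * W T',
    then no a n changes (two_point_resampling). In the tree of size n, the
    numbers Z and Y of copies of T and T' therefore satisfy
    E (lam ^ Z * mu ^ Y) = 1.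

    Some tree is missing above the threshold. Let T be the star with m leaves
    and T' the path of the same size. Taking mu = 1 - 1 / (2 n) above bounds
    the probability that Z > 0 by 4 n W T / W T' (sum_containing_le). That
    ratio is the probability of m children up to a factor exponential in m,
    and f beats every linear function, so the bound tends to 0 as soon as
    f m >= (1 + delta) log n.

    All trees are present below the threshold. It suffices to find every tree
    T of size exactly k. Since f is superadditive, W T is at least
    n ^ (- 1 + delta / 2), whereas the path T' of size k has weight n ^ (- o(1)).
    Taking lam = 0 shows that a tree with at least y copies of T' avoids T with
    probability at most (1 + W T) ^ - y (sum_avoiding_le), which survives a
    union bound over T once y is about n W T' / k. That there are so many
    copies of T' is a large-deviation estimate: halving the weight of T' makes
    the generating function of the total weights converge beyond 1
    (damped_gf_le1), so trees with few copies have an exponentially small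
    weight (sum_few_le), and it remains to see that a n is not that small.

    For this last point, the functional equation F = z phi(F) of the
    generating function of a, together with mean 1 and finite variance, gives
    1 - F(1 - s) of order sqrt s, hence polynomial upper and lower bounds for
    the tail of the total progeny, hence sizes L with a L polynomially small in
    every interval between x and a multiple of x ^ 2. Grafting such trees
    together gives a n >= exp (- C n ^ (7/8)) (tree_sum_lower_bound).

    The convergence of K_n / f^-1 (log n) follows because f (c x) <= c f x for
    0 <= c <= 1: multiplying log n by 1 - delta or 1 + delta moves the inverse
    of f by at most the same factor. *)

Local Open Scope classical_set_scope.
Local Open Scope ring_scope.

(** * Plane trees and their enumeration by size *)

Section enumeration.
Local Open Scope nat_scope.

Definition forest_size (s : seq plane_tree) : nat := sumn (map tree_size s).

Lemma tree_size_gt0 t : 0 < tree_size t.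
Proof. by case: t. Qed.

Lemma size_le_forest_size s : size s <= forest_size s.
Proof.
elim: s => //= t s IHs; rewrite /forest_size /=.
by have := tree_size_gt0 t; rewrite /forest_size in IHs; lia.
Qed.

Lemma tree_size_le_forest_size t s : t \in s -> tree_size t <= forest_size s.
Proof.
elim: s => //= u s IHs; rewrite inE /forest_size /= => /predU1P[->|/IHs].
  exact: leq_addr.
by rewrite /forest_size; lia.
Qed.

Lemma plane_tree_mem_ind (Q : plane_tree -> Prop) :
  (forall s, (forall t, t \in s -> Q t) -> Q (Node s)) -> forall t, Q t.
Proof.
move=> QN; elim/plane_tree_nested_ind => s IHs; apply: QN => t ts.
by rewrite -(nth_index (Node [::]) ts); apply: IHs; rewrite index_mem.
Qed.

(** A nonempty forest of total size n.+1 is Node c :: s for two forests c and s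
    whose sizes add up to n. The fuel only serves structural recursion. *)
Fixpoint forests_upto (fuel n : nat) : seq (seq plane_tree) :=
  match n, fuel with
  | 0, _ => [:: [::]]
  | n'.+1, 0 => [::]
  | n'.+1, fuel'.+1 =>
      [seq Node u.1 :: u.2 | i <- iota 0 n'.+1,
         u <- [seq (c, s) | c <- forests_upto fuel' i,
                            s <- forests_upto fuel' (n' - i)]]
  end.

Definition forests n := forests_upto n n.

Lemma forests_uptoS f n :
  forests_upto f.+1 n.+1 =
  [seq Node u.1 :: u.2 | i <- iota 0 n.+1,
     u <- [seq (c, s) | c <- forests_upto f i, s <- forests_upto f (n - i)]].
Proof. by []. Qed.

Lemma forests_upto_fuel f1 f2 n :
  n <= f1 -> n <= f2 -> forests_upto f1 n = forests_upto f2 n.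
Proof.
elim: f1 f2 n => [|f1 IH] [|f2] [|n] //; rewrite !ltnS => le1 le2.
rewrite !forests_uptoS; congr flatten; apply/eq_in_map => i.
rewrite mem_iota => /andP[_ lei].
by rewrite (IH f2 i) ?(IH f2 (n - i)) //; lia.
Qed.

Lemma forestsS n :
  forests n.+1 = [seq Node u.1 :: u.2 | i <- iota 0 n.+1,
         u <- [seq (c, s) | c <- forests i, s <- forests (n - i)]].
Proof.
rewrite /forests forests_uptoS; congr flatten; apply/eq_in_map => i.
rewrite mem_iota => /andP[_ lei].
by rewrite (forests_upto_fuel n i i) ?(forests_upto_fuel n (n - i) (n - i)) //; lia.
Qed.

Lemma mem_forests s n : (s \in forests n) = (forest_size s == n).
Proof.
elim/ltn_ind: n s => -[|n] IHn s.
  rewrite /forests /= inE; case: s => [|t s] //.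
  apply/idP/eqP => //; rewrite /forest_size /=.
  by have := tree_size_gt0 t; lia.
rewrite forestsS; apply/allpairsPdep/eqP.
  move=> [i [_ [+ /allpairsP[[c r] /= [ci ri ->]] ->]]].
  rewrite mem_iota => /andP[_ lei]; move: ci ri; rewrite !IHn; try lia.
  by rewrite /forest_size /= => /eqP -> /eqP ->; lia.
case: s => [//|[c] r]; rewrite /forest_size /= => -[cr].
exists (forest_size c), (c, r); split => //.
  by rewrite -[_ :: _]/(iota 0 n.+1) mem_iota /forest_size; lia.
apply/allpairsP; exists (c, r); split => //=; rewrite IHn ?eqxx //;
  rewrite /forest_size; lia.
Qed.

Lemma forests_uniq n : uniq (forests n).
Proof.
elim/ltn_ind: n => -[|n] IHn //.
rewrite forestsS; apply: allpairs_uniq_dep; first exact: iota_uniq.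
  move=> i; rewrite mem_iota => /andP[_ lei].
  apply: allpairs_uniq; try (apply: IHn; lia).
  by move=> [c r] [c' r'] _ _ [-> ->].
move=> x y /allpairsPdep[i [u [_ /allpairsP[[c r] [ci _ ->]] ->]]].
move=> /allpairsPdep[j [v [_ /allpairsP[[c' r'] [cj _ ->]] ->]]] /=.
by case=> ec er; move: ci cj; rewrite /= ec er !mem_forests => /eqP -> /eqP ->.
Qed.

Definition trees n : seq plane_tree :=
  if n is n'.+1 then map Node (forests n') else [::].

Lemma mem_trees t n : (t \in trees n) = (tree_size t == n).
Proof.
case: n => [|n]; first by case: t.
case: t => s; rewrite /= mem_map; last by move=> ? ? [].
by rewrite mem_forests eqSS.
Qed.

Lemma trees_uniq n : uniq (trees n).
Proof.
case: n => //= n; rewrite map_inj_uniq ?forests_uniq //.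
by move=> ? ? [].
Qed.

Lemma fringe_subtreesE s :
  fringe_subtrees (Node s) = Node s :: flatten (map fringe_subtrees s).
Proof. by []. Qed.

Lemma fringe_self t : t \in fringe_subtrees t.
Proof. by case: t => s; rewrite fringe_subtreesE mem_head. Qed.

Lemma size_fringe_subtrees t : size (fringe_subtrees t) = tree_size t.
Proof.
elim/plane_tree_mem_ind: t => s IHs /=.
rewrite size_flatten /shape -map_comp; congr (sumn _).+1.
exact/eq_in_map.
Qed.

Lemma fringe_tree_size t u : u \in fringe_subtrees t -> tree_size u <= tree_size t.
Proof.
elim/plane_tree_mem_ind: t => s IHs; rewrite fringe_subtreesE inE.
case/predU1P => [-> //|/flatten_mapP[v vs uv]].
rewrite (leq_trans (IHs _ vs uv)) //.
exact/leqW/tree_size_le_forest_size.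
Qed.

Lemma fringe_trans t u v :
  u \in fringe_subtrees t -> v \in fringe_subtrees u -> v \in fringe_subtrees t.
Proof.
elim/plane_tree_mem_ind: t => s IHs; rewrite fringe_subtreesE inE.
case/predU1P => [-> //|/flatten_mapP[w ws uw] vu].
rewrite inE; apply/orP; right; apply/flatten_mapP; exists w => //.
exact: IHs ws uw vu.
Qed.

Definition unary_over (j : nat) (t : plane_tree) : plane_tree :=
  iter j (fun u => Node [:: u]) t.

Lemma unary_over_size j t : tree_size (unary_over j t) = j + tree_size t.
Proof. by elim: j => //= j ->; lia. Qed.

Lemma fringe_unary_over j t : t \in fringe_subtrees (unary_over j t).
Proof.
elim: j => [|j IH] /=; first exact: fringe_self.
by rewrite inE cats0 IH orbT.
Qed.

Definition path_tree k : plane_tree := unary_over k.-1 (Node [::]).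
Definition star_tree m : plane_tree := Node (nseq m (Node [::])).

Lemma path_tree_size k : 0 < k -> tree_size (path_tree k) = k.
Proof. by move=> k0; rewrite unary_over_size /=; lia. Qed.

Lemma star_tree_size m : tree_size (star_tree m) = m.+1.
Proof. by congr S; elim: m => //= m ->. Qed.

End enumeration.

(** * Weights that multiply along trees *)

Section forest_sums.
Context {R : comNzRingType}.
Implicit Types (g : plane_tree -> R).

Definition tree_sum g n : R := \sum_(t <- trees n) g t.

Definition forest_sum g m n : R :=
  \sum_(s <- forests n | size s == m) \prod_(t <- s) g t.

Lemma tree_sum0 g : tree_sum g 0 = 0.
Proof. by rewrite /tree_sum big_nil. Qed.

Lemma forest_sum0 g n : forest_sum g 0 n = (n == 0%N)%:R.
Proof.
rewrite /forest_sum; case: n => [|n].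
  by rewrite /forests /= big_cons /= big_nil big_nil addr0.
rewrite big_seq_cond big1 // => s; rewrite mem_forests.
by move=> /andP[/eqP sn /eqP/size0nil s0]; rewrite s0 in sn.
Qed.

Lemma forest_sumS g m n :
  forest_sum g m.+1 n.+1 =
  \sum_(i < n.+1) tree_sum g i.+1 * forest_sum g m (n - i).
Proof.
rewrite [LHS]/forest_sum forestsS big_flatten big_map.
rewrite -[RHS](big_mkord xpredT
  (fun i => tree_sum g i.+1 * forest_sum g m (n - i))).
rewrite /index_iota subn0; apply: eq_bigr => i _.
rewrite big_map big_mkcond big_allpairs.
rewrite /tree_sum big_map big_distrl /=; apply: eq_bigr => c _.
rewrite /forest_sum big_distrr /= [RHS]big_mkcond; apply: eq_bigr => r _.
by rewrite eqSS; case: ifP => // _; rewrite big_cons.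
Qed.

Lemma forest_sumS0 g m : forest_sum g m.+1 0 = 0.
Proof. by rewrite /forest_sum big_mkcond big_seq1. Qed.

(** Listing the trees of a forest from left to right is a convolution, so the
    sum over forests of m trees is a coefficient of an m-th power. In particular
    it depends on g only through the sums of g over the trees of each size. *)
Lemma forest_sum_coef g m n (P : {poly R}) :
  (forall i, (i <= n)%N -> P`_i = tree_sum g i) ->
  (P ^+ m)`_n = forest_sum g m n.
Proof.
elim: m n => [|m IHm] n hP; first by rewrite expr0 coef1 forest_sum0.
rewrite exprS coefM big_ord_recl hP // tree_sum0 mul0r add0r.
case: n hP => [|n] hP; first by rewrite big_ord0 forest_sumS0.
rewrite forest_sumS; apply: eq_bigr => i _.
rewrite hP ?ltn_ord // IHm ?subSS // => j lej.
by apply: hP; rewrite (leq_trans lej) // /lift /= /bump /=; lia.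
Qed.

Variable p : nat -> R.

(** The factor h is there to reweight chosen fringe subtrees; as it multiplies
    node by node, the recursion at the root survives the reweighting. *)
Fixpoint local_weight (h : plane_tree -> R) (t : plane_tree) : R :=
  let: Node s := t in
  h (Node s) * p (size s) * \prod_(w <- map (local_weight h) s) w.

Lemma local_weightE h s :
  local_weight h (Node s) =
  h (Node s) * p (size s) * \prod_(t <- s) local_weight h t.
Proof. by rewrite /= big_map. Qed.

Definition gw_weight : plane_tree -> R := local_weight (fun=> 1).

Lemma gw_weightE s :
  gw_weight (Node s) = p (size s) * \prod_(t <- s) gw_weight t.
Proof. by rewrite /gw_weight local_weightE mul1r. Qed.

(** Splitting a tree at its root: coefficientwise, this is the functional
    equation F = z phi(F), where phi is the offspring generating function. A
    local factor h does not disturb it in the sizes where h is 1. *)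
Lemma tree_sum_rec h n M : (forall t, tree_size t = n.+1 -> h t = 1) ->
  (n < M)%N ->
  tree_sum (local_weight h) n.+1 =
  \sum_(m < M) p m * forest_sum (local_weight h) m n.
Proof.
move=> h1 nM; rewrite /tree_sum /= big_map /forest_sum.
under [RHS]eq_bigr do rewrite big_distrr /= big_mkcond.
rewrite exchange_big /= big_seq [RHS]big_seq; apply: eq_bigr => s.
rewrite mem_forests => /eqP sn.
have sM : (size s < M)%N.
  by apply: leq_ltn_trans nM; rewrite -sn size_le_forest_size.
rewrite (bigD1 (Ordinal sM)) //= eqxx big_map h1 /= -/(forest_size s) ?sn //.
rewrite mul1r [X in _ = _ + X]big1 ?addr0 // => m /eqP/= neq.
by case: eqP => // sm; case: neq; apply/val_inj.
Qed.

Lemma local_weight_small h k t : (forall u, tree_size u != k -> h u = 1) ->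
  (tree_size t < k)%N -> local_weight h t = gw_weight t.
Proof.
move=> h1; elim/plane_tree_mem_ind: t => s IHs sk.
rewrite local_weightE gw_weightE h1 ?mul1r; last by rewrite neq_ltn sk.
congr (_ * _); apply: eq_big_seq => t ts; apply: IHs => //.
by apply: leq_ltn_trans sk; apply/leqW/tree_size_le_forest_size.
Qed.

Lemma tree_sum_local_at h k : (forall u, tree_size u != k -> h u = 1) ->
  tree_sum (local_weight h) k = \sum_(t <- trees k) h t * gw_weight t.
Proof.
move=> h1; apply: eq_big_seq => -[s]; rewrite mem_trees => /eqP sk.
rewrite local_weightE gw_weightE -mulrA; congr (_ * (_ * _)).
apply: eq_big_seq => t ts; apply: (local_weight_small h k) => //.
by rewrite -sk ltnS tree_size_le_forest_size.
Qed.

Lemma local_weight_fringe h t :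
  local_weight h t = gw_weight t * \prod_(u <- fringe_subtrees t) h u.
Proof.
elim/plane_tree_mem_ind: t => s IHs.
rewrite local_weightE gw_weightE fringe_subtreesE big_cons big_flatten big_map.
rewrite (eq_big_seq _ IHs) big_split /=; ring.
Qed.

Lemma eq_forest_sum g g' m n :
  (forall i, (i <= n)%N -> tree_sum g i = tree_sum g' i) ->
  forest_sum g m n = forest_sum g' m n.
Proof.
move=> gg'; rewrite -!(forest_sum_coef _ _ _ (\poly_(i < n.+1) tree_sum g i)) //.
  by move=> i lei; rewrite coef_poly ltnS lei gg'.
by move=> i lei; rewrite coef_poly ltnS lei.
Qed.

(** The recursion at the root sees the trees of size k only through their
    total weight. Probabilistically: given the rest of a conditioned tree, its
    fringe subtrees of size k are independent and may be resampled. *)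
Lemma local_weight_resampling h k : (forall u, tree_size u != k -> h u = 1) ->
  \sum_(t <- trees k) h t * gw_weight t = \sum_(t <- trees k) gw_weight t ->
  forall n, tree_sum (local_weight h) n = tree_sum gw_weight n.
Proof.
move=> h1 hk; elim/ltn_ind => -[|n] IHn; first by rewrite !tree_sum0.
have [nk|nk] := eqVneq n.+1 k; first by rewrite nk tree_sum_local_at.
rewrite /gw_weight !(tree_sum_rec _ n n.+1) //; last first.
  by move=> t tn; apply: h1; rewrite tn.
apply: eq_bigr => m _; congr (_ * _).
by apply: eq_forest_sum => i lei; apply: IHn.
Qed.

End forest_sums.

(** * The law of a Galton-Watson tree *)

Section node_degrees.

Fixpoint node_degrees (t : plane_tree) : seq (seq nat * nat) :=
  let: Node s := t in
  ([::], size s) ::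
  [seq (i :: v.1, v.2) | i <- iota 0 (size s),
                         v <- nth [::] (map node_degrees s) i].

Lemma node_degreesE s : node_degrees (Node s) = ([::], size s) ::
  [seq (i :: v.1, v.2) | i <- iota 0 (size s),
                         v <- nth [::] (map node_degrees s) i].
Proof. by []. Qed.

Lemma mem_node_degrees s v d :
  ((v, d) \in node_degrees (Node s)) =
  if v is i :: v' then (i < size s)%N && ((v', d) \in node_degrees (nth (Node [::]) s i))
  else d == size s.
Proof.
rewrite node_degreesE in_cons xpair_eqE.
case: v => [|i v].
  rewrite eqxx andTb; case: eqP => //= _.
  by apply/negbTE/negP => /allpairsPdep[i [u [_ _]]].
apply/allpairsPdep/andP => [[j [[u e] [+ + [-> -> ->]]]]|[si vi]].
  rewrite mem_iota /= => js; rewrite (nth_map (Node [::]))//.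
by exists i, (v, d); rewrite mem_iota (nth_map (Node [::])).
Qed.

(** A finite tree constrains one variable per node and no other, so the event
    that the Galton-Watson tree equals t is a cylinder. *)
Lemma generatesP x t :
  generates x t <-> forall v d, (v, d) \in node_degrees t -> x v = d.
Proof.
split.
  elim=> {x t} x s x0 _ IHs [|i v] d; rewrite mem_node_degrees.
    by move/eqP ->.
  by case/andP => si; apply: IHs.
elim/plane_tree_nested_ind: t x => s IHs x xs; constructor.
  by apply: xs; rewrite mem_node_degrees.
move=> i si; apply: IHs => // v d vd.
by apply: xs; rewrite mem_node_degrees si.
Qed.

Lemma generates_inj x t t' : generates x t -> generates x t' -> t = t'.
Proof.
move=> xt; elim: xt t' => {x t} x s x0 _ IHs t' xt'.
case: _ _ / xt' x0 IHs => {x t'} x s' -> xs' ss' IHs.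
congr Node; apply: (@eq_from_nth _ (Node [::])) => // i si.
by apply: IHs => //; apply: xs'; rewrite ss'.
Qed.

Lemma uniq_node_degrees t : uniq (map fst (node_degrees t)).
Proof.
elim/plane_tree_nested_ind: t => s IHs.
rewrite node_degreesE map_cons map_allpairs cons_uniq; apply/andP; split.
  by apply/negP => /allpairsPdep[i [u [_ _]]].
rewrite -(allpairs_mapr (fun i => cons i) (fun=> fst)).
apply: allpairs_uniq_dep; first exact: iota_uniq.
  move=> i; rewrite mem_iota => /andP[_ si].
  by rewrite (nth_map (Node [::])) //; exact: IHs.
by move=> [i u] [j v] _ _ /= [-> ->].
Qed.

End node_degrees.

Lemma uniq_fst_functional (T S : eqType) (l : seq (T * S)) u e e' :
  uniq (map fst l) -> (u, e) \in l -> (u, e') \in l -> e = e'.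
Proof.
elim: l => //= -[v c] l IHl /andP[vl ul]; rewrite !inE !xpair_eqE.
case/orP => [/andP[/eqP uv /eqP ->]|ue]; case/orP => [/andP[/eqP uv' /eqP ->]|ue'] //.
- by case/negP: vl; apply/mapP; exists (u, e').
- by case/negP: vl; apply/mapP; exists (u, e).
- exact: IHl.
Qed.

Section galton_watson_law.
Import finmap.
Context {R : realType} {d d0 : measure_display} {Omega : measurableType d}
  {Omega0 : measurableType d0} {P : probability Omega R}
  {P0 : probability Omega0 R}.
Variables (X : seq nat -> {RV P >-> nat}) (xi : {RV P0 >-> nat}).
Hypothesis X_iid : iid_copies X xi.

Local Notation p := (nat_pmf xi).

Lemma measurable_RV_preimage (u : seq nat) (B : set nat) :
  measurable (X u @^-1` B).
Proof. by rewrite -[_ @^-1` _]setTI; apply: measurable_funP. Qed.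

Lemma gw_weight_node_degrees t :
  gw_weight p t = \prod_(v <- node_degrees t) p v.2.
Proof.
elim/plane_tree_nested_ind: t => s IHs.
rewrite gw_weightE node_degreesE big_cons big_allpairs_dep /=; congr (_ * _).
rewrite (big_nth (Node [::])) /index_iota subn0.
apply: eq_big_seq => i; rewrite mem_iota => /andP[_ si].
by rewrite IHs // (nth_map (Node [::])).
Qed.

Let address_set t := seq_fset tt (map fst (node_degrees t)).

Lemma gw_event_bigcap t :
  gw_event X [set t] = \bigcap_(u in [set` address_set t])
                         (X u @^-1` [set e | (u, e) \in node_degrees t]).
Proof.
apply/seteqP; split=> w /=.
  move=> [_ -> /generatesP tw] u /=; rewrite seq_fsetE => /mapP[[u' e] ue ->].
  by rewrite /preimage /= (tw _ _ ue).
move=> wt; exists t => //; apply/generatesP => u e ue.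
have /wt : [set` address_set t] u.
  by rewrite /= seq_fsetE; apply/mapP; exists (u, e).
move=> ue'; exact: uniq_fst_functional (uniq_node_degrees t) ue' ue.
Qed.

Lemma measurable_gw_event1 t : measurable (gw_event X [set t]).
Proof.
rewrite gw_event_bigcap; apply: fin_bigcap_measurable => // u _.
exact: measurable_RV_preimage.
Qed.

(** Independence turns the probability of the cylinder into a product over
    the nodes. *)
Lemma gw_event1_prob t : P (gw_event X [set t]) = (gw_weight p t)%:E.
Proof.
have [indep same_law] := X_iid; rewrite gw_event_bigcap indep //.
rewrite (perm_big _ (seq_fset_perm tt _)) undup_id ?uniq_node_degrees //.
rewrite big_map gw_weight_node_degrees -prodEFin.
apply: eq_big_seq => -[u e] ue /=.
rewrite -(same_law u) /nat_pmf fineK ?fin_num_measure //; last first.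
  exact: measurable_RV_preimage.
congr (P (_ @^-1` _)); apply/seteqP; split => [e' ue'|_ ->] //=.
exact: uniq_fst_functional (uniq_node_degrees t) ue' ue.
Qed.

Lemma gw_event_trees_prob (A : set plane_tree) n :
  P (gw_event X (A `&` [set t | tree_size t = n])) =
  (\sum_(t <- trees n | `[< A t >]) gw_weight p t)%:E.
Proof.
have -> : gw_event X (A `&` [set t | tree_size t = n]) =
    \bigcup_(t in [set` [seq t <- trees n | `[< A t >]]]) gw_event X [set t].
  apply/seteqP; split=> w /=.
    move=> [t [At tn] wt]; exists t; last by exists t.
    by rewrite /= mem_filter mem_trees tn eqxx andbT; apply/asboolP.
  move=> [t + [_ -> wt]]; rewrite /= mem_filter mem_trees.
  by move=> /andP[/asboolP At /eqP tn]; exists t.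
rewrite measure_fin_bigcup //=; first last.
- by move=> t _; exact: measurable_gw_event1.
- move=> t t' _ _ [w [[_ -> wt] [_ -> wt']]].
  exact: generates_inj wt wt'.
rewrite -fsbig_seq ?filter_uniq ?trees_uniq // big_filter.
under eq_bigr do rewrite gw_event1_prob.
by rewrite sumEFin.
Qed.

(** Finitely many trees have size n, so conditioning on the size leaves a ratio
    of two finite sums of weights. *)
Lemma cond_gw_probE n (A : set plane_tree) :
  cond_gw_prob X n A =
  (\sum_(t <- trees n | `[< A t >]) gw_weight p t) / tree_sum (gw_weight p) n.
Proof.
rewrite /cond_gw_prob gw_event_trees_prob /=; congr (_ / _).
rewrite -[[set t | _]]setTI gw_event_trees_prob /= /tree_sum.
by apply: eq_bigl => t; apply/asboolP.
Qed.

End galton_watson_law.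

(** * Moments of the offspring law *)

Section moments.
Context {R : realType} {d0 : measure_display} {Omega0 : measurableType d0}
  {P0 : probability Omega0 R}.
Variable xi : {RV P0 >-> nat}.

Local Notation p := (nat_pmf xi).

Lemma integral_nat_RV (g : nat -> R) : (forall i, 0 <= g i) ->
  (\int[P0]_w (g (xi w))%:E = \sum_(0 <= i <oo) (g i * p i)%:E)%E.
Proof.
move=> g0; have mxi (B : set nat) : measurable (xi @^-1` B).
  by rewrite -[_ @^-1` _]setTI; apply: measurable_funP.
have mg : measurable_fun [set: Omega0] (EFin \o (g \o xi)).
  apply/measurable_EFinP => _ B mB; rewrite setTI.
  exact: (mxi (g @^-1` B)).
have -> : [set: Omega0] = \bigcup_i (xi @^-1` [set i]).
  by apply/seteqP; split => // w _; exists (xi w).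
rewrite ge0_integral_bigcup //=.
- apply: eq_eseriesr => i _.
  rewrite (eq_integral (cst (g i)%:E)); last first.
    by move=> w; rewrite inE /= => ->.
  by rewrite integral_cst // /nat_pmf EFinM fineK // fin_num_measure.
- by apply: measurable_funS mg.
- by move=> w _; rewrite lee_fin.
- by move=> i j _ _ [w [/= <- <-]].
Qed.

Lemma nneseries_EFin_cvg (u : nat -> R) (l : R) : (forall i, 0 <= u i) ->
  (\sum_(0 <= i <oo) (u i)%:E = l%:E)%E ->
  \sum_(i < n) u i @[n --> \oo] --> l.
Proof.
move=> u0 ul.
have : (\sum_(0 <= i < n) (u i)%:E)%E @[n --> \oo] --> l%:E.
  by rewrite -ul; apply: is_cvg_nneseries => i _ _; rewrite lee_fin.
move=> /fine_cvg; apply: cvg_trans; apply: near_eq_cvg.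
by apply: nearW => n /=; rewrite sumEFin /= big_mkord.
Qed.

Lemma nat_pmf_ge0 i : 0 <= p i.
Proof. exact: fine_ge0. Qed.

Lemma nat_pmf_total : \sum_(i < n) p i @[n --> \oo] --> (1 : R).
Proof.
apply: nneseries_EFin_cvg nat_pmf_ge0 _.
under eq_eseriesr do rewrite -[p _]mul1r.
rewrite -(integral_nat_RV (fun=> 1)) //=.
rewrite (integral_cst P0 measurableT 1%E). rewrite mul1e.
exact: probability_setT.
Qed.

Lemma nat_pmf_mean : ('E_P0[fun w => (xi w)%:R] = 1)%E ->
  \sum_(i < n) i%:R * p i @[n --> \oo] --> (1 : R).
Proof.
rewrite unlock (integral_nat_RV (fun i => i%:R)) // => E1.
by apply: nneseries_EFin_cvg E1 => i; rewrite mulr_ge0 // nat_pmf_ge0.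
Qed.

(** As the mean is 1, these partial sums are bounded by the variance. *)
Lemma nat_pmf_second_moment : ('E_P0[fun w => (xi w)%:R] = 1)%E ->
  ('V_P0[fun w => (xi w)%:R] < +oo)%E ->
  exists v : R, forall n, \sum_(i < n) (i%:R - 1) ^+ 2 * p i <= v.
Proof.
move=> E1; rewrite /variance unlock E1 /= unlock /=.
rewrite [X in (X < _)%E](integral_nat_RV (fun i => (i%:R - 1) ^+ 2)); last first.
  by move=> i; exact: sqr_ge0.
set S := (X in (X < _)%E) => Soo.
have u0 i : 0 <= (i%:R - 1) ^+ 2 * p i by rewrite mulr_ge0 ?sqr_ge0 ?nat_pmf_ge0.
have S0 : (0 <= S)%E by apply: nneseries_ge0 => i _ _; rewrite lee_fin.
exists (fine S) => n; rewrite -lee_fin fineK; last by rewrite ge0_fin_numE.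
rewrite -sumEFin -(big_mkord xpredT (fun i => ((i%:R - 1) ^+ 2 * p i)%:E)).
by apply: nneseries_lim_ge => i _ _; rewrite lee_fin.
Qed.

End moments.

(** * Generating functions of weighted trees *)

Section generating_function.
Context {R : realType}.
Variable p : nat -> R.
Hypothesis p_gt0 : forall i, 0 < p i.
Hypothesis sum_p_le1 : forall n, \sum_(i < n) p i <= 1.

Implicit Types (g h : plane_tree -> R).
Local Notation W := (gw_weight p).
Local Notation a := (tree_sum W).

Let p_ge0 i : 0 <= p i. Proof. exact: ltW. Qed.

Lemma gw_weight_gt0 t : 0 < W t.
Proof.
elim/plane_tree_mem_ind: t => s IHs; rewrite gw_weightE mulr_gt0 //.
by rewrite big_seq prodr_gt0.
Qed.

Lemma gw_weight_ge0 t : 0 <= W t.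
Proof. exact/ltW/gw_weight_gt0. Qed.

Lemma local_weight_ge0 h t : (forall u, 0 <= h u) -> 0 <= local_weight p h t.
Proof.
move=> h0; rewrite local_weight_fringe mulr_ge0 ?prodr_ge0 //.
exact/ltW/gw_weight_gt0.
Qed.

Lemma pmf_le1 i : p i <= 1.
Proof.
apply: le_trans (sum_p_le1 i.+1); rewrite big_ord_recr /= lerDr.
by apply: sumr_ge0 => j _; exact/ltW.
Qed.

Lemma tree_sum_ge0 g n : (forall t, 0 <= g t) -> 0 <= tree_sum g n.
Proof. by move=> g0; apply: sumr_ge0. Qed.

Lemma le_tree_sum g t : (forall t, 0 <= g t) -> g t <= tree_sum g (tree_size t).
Proof.
move=> g0; rewrite /tree_sum (big_rem t) /=; last by rewrite mem_trees.
by rewrite lerDl sumr_ge0.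
Qed.

Lemma tree_sum_gt0 n : (0 < n)%N -> 0 < a n.
Proof.
move=> n0; rewrite -(path_tree_size n n0).
apply: lt_le_trans (le_tree_sum W _ _); first exact: gw_weight_gt0.
exact: gw_weight_ge0.
Qed.

(** The generating function of the sums over the trees of each size, cut off
    after size n so that no convergence has to be discussed. *)
Definition tree_gf g n (z : R) : R := \sum_(i < n.+1) tree_sum g i * z ^+ i.

Lemma tree_gf_poly g n z : tree_gf g n z = (\poly_(i < n.+1) tree_sum g i).[z].
Proof. by rewrite horner_poly. Qed.

Lemma tree_gf_ge0 g n z : (forall t, 0 <= g t) -> 0 <= z -> 0 <= tree_gf g n z.
Proof.
by move=> g0 z0; apply: sumr_ge0 => i _; rewrite mulr_ge0 ?exprn_ge0 ?tree_sum_ge0.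
Qed.

Lemma tree_gf_mono g z n n' : (forall t, 0 <= g t) -> 0 <= z -> (n <= n')%N ->
  tree_gf g n z <= tree_gf g n' z.
Proof.
move=> g0 z0 nn'; rewrite /tree_gf -!(big_mkord xpredT (fun i => tree_sum g i * z ^+ i)).
rewrite [leRHS](big_cat_nat (n := n.+1)) //= lerDl sumr_ge0 // => i _.
by rewrite mulr_ge0 ?exprn_ge0 ?tree_sum_ge0.
Qed.

Lemma tree_gfS g n z : tree_gf g n.+1 z = z * \sum_(j < n.+1) tree_sum g j.+1 * z ^+ j.
Proof.
rewrite /tree_gf big_ord_recl tree_sum0 mul0r add0r mulr_sumr.
by apply: eq_bigr => i _; rewrite /= /bump /= add1n exprS mulrCA.
Qed.

Lemma coef_exp_le (P Q : {poly R}) m j : (forall i, 0 <= P`_i <= Q`_i) ->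
  0 <= (P ^+ m)`_j <= (Q ^+ m)`_j.
Proof.
move=> PQ; elim: m j => [|m IHm] j; first by rewrite !expr0 coef1 ler0n lexx.
rewrite !exprS !coefM; apply/andP; split.
  apply: sumr_ge0 => i _; rewrite mulr_ge0 //; first by case/andP: (PQ i).
  by case/andP: (IHm (j - i)%N).
apply: ler_sum => i _; have /andP[? ?] := PQ i; have /andP[? ?] := IHm (j - i)%N.
exact: ler_pM.
Qed.

(** The power on the right also counts forests whose total size exceeds n. *)
Lemma forest_gf_le g m n z : (forall t, 0 <= g t) -> 0 <= z ->
  \sum_(j < n.+1) forest_sum g m j * z ^+ j <= tree_gf g n z ^+ m.
Proof.
move=> g0 z0; set P := \poly_(i < n.+1) tree_sum g i.
rewrite tree_gf_poly -/P -horner_exp (horner_coef_wide _ (leq_maxr n.+1 _)).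
rewrite -(big_mkord xpredT (fun j => (P ^+ m)`_j * z ^+ j)).
rewrite (big_cat_nat (n := n.+1)) ?leq_maxl //= big_mkord.
have -> : \sum_(j < n.+1) (P ^+ m)`_j * z ^+ j =
          \sum_(j < n.+1) forest_sum g m j * z ^+ j.
  apply: eq_bigr => j _; congr (_ * _); apply: forest_sum_coef => i ij.
  by rewrite coef_poly (leq_ltn_trans ij).
rewrite lerDl sumr_ge0 // => j _; rewrite mulr_ge0 ?exprn_ge0 //.
have PP i : 0 <= P`_i <= P`_i.
  by rewrite lexx andbT coef_poly; case: ifP => // _; exact: tree_sum_ge0.
by case/andP: (coef_exp_le P P m j PP).
Qed.

(** One half of F = z phi(F). When h changes the total weight in size k.+1, the
    change enters as a correction to the coefficient of z ^ k.+1 alone. *)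
Lemma tree_gf_functional_le h k n z : (forall u, 0 <= h u) ->
  (forall u, tree_size u != k.+1 -> h u = 1) -> 0 <= z ->
  tree_gf (local_weight p h) n.+1 z <=
  z * (\sum_(m < n.+1) p m * tree_gf (local_weight p h) n z ^+ m) -
  (if (k <= n)%N then (a k.+1 - tree_sum (local_weight p h) k.+1) * z ^+ k.+1 else 0).
Proof.
move=> h0 h1 z0; set b := local_weight p h.
have b0 t : 0 <= b t by exact: local_weight_ge0.
set D := a k.+1 - tree_sum b k.+1.
have bS j : (j <= n)%N -> tree_sum b j.+1 =
    \sum_(m < n.+1) p m * forest_sum b m j - (if j == k then D else 0).
  move=> jn; have [jk|jk] := eqVneq j k; last first.
    rewrite subr0 (tree_sum_rec p h j n.+1) // => t tj.
    by apply: h1; rewrite tj eqSS.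
  rewrite jk in jn *.
  suff -> : \sum_(m < n.+1) p m * forest_sum b m k = a k.+1.
    by rewrite /D; ring.
  rewrite (tree_sum_rec p (fun=> 1) k n.+1) //.
  apply: eq_bigr => m _.
  congr (_ * _); apply: eq_forest_sum => i ik; apply: eq_big_seq => t.
  rewrite mem_trees => /eqP ti; apply: (local_weight_small p h k.+1) => //.
  by rewrite ti.
rewrite tree_gfS.
have -> : \sum_(j < n.+1) tree_sum b j.+1 * z ^+ j =
    \sum_(m < n.+1) p m * (\sum_(j < n.+1) forest_sum b m j * z ^+ j) -
    \sum_(j < n.+1) (if j == k :> nat then D * z ^+ k else 0).
  under [X in _ = X - _]eq_bigr do rewrite mulr_sumr.
  rewrite exchange_big /= -sumrB; apply: eq_bigr => j _.
  rewrite bS; last by rewrite -ltnS.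
  rewrite mulrBl mulr_suml; congr (_ - _).
    by apply: eq_bigr => m _; rewrite mulrA.
  by case: eqP => [->|]; rewrite ?mul0r.
rewrite mulrBr lerB //.
  apply: ler_wpM2l => //; apply: ler_sum => m _.
  by apply: ler_wpM2l; [exact/ltW | exact: forest_gf_le].
rewrite -big_mkcond /=; case: ifPn => kn.
  rewrite (big_pred1 (Ordinal (kn : k < n.+1)%N)) //.
  by rewrite exprS mulrCA.
by rewrite big1 ?mulr0 // => j /eqP jk; case/negP: kn; rewrite -jk -ltnS.
Qed.

(** Since phi(1) <= 1, the value 1 is a supersolution of F = z phi(F) for z <= 1,
    and induction on the cut-off keeps the generating function below it. *)
Lemma tree_gf_le1 n z : 0 <= z <= 1 -> tree_gf W n z <= 1.
Proof.
move=> /andP[z0 z1]; elim: n => [|n IHn].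
  by rewrite /tree_gf big_ord_recl big_ord0 tree_sum0 mul0r addr0.
have W0 := gw_weight_ge0.
apply: le_trans (tree_gf_functional_le (fun=> 1) n n z _ _ z0) _ => //.
rewrite -/W subrr mul0r if_same subr0 -[leRHS]mul1r ler_pM //.
  by apply: sumr_ge0 => m _; rewrite mulr_ge0 // exprn_ge0 // tree_gf_ge0.
apply: le_trans (sum_p_le1 n.+1); apply: ler_sum => m _.
by rewrite ler_piMr // exprn_ile1 // tree_gf_ge0.
Qed.

Lemma tree_sum_total_le1 n : \sum_(i < n.+1) a i <= 1.
Proof.
apply: le_trans (tree_gf_le1 n 1 _); last by rewrite ler01 lexx.
by apply: ler_sum => i _; rewrite expr1n mulr1.
Qed.

Lemma tree_sum_le1 n : a n <= 1.
Proof.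
apply: le_trans (tree_sum_total_le1 n); rewrite big_ord_recr /= lerDr.
by apply: sumr_ge0 => i _; exact: tree_sum_ge0 gw_weight_ge0.
Qed.

Lemma gw_weight_le1 t : W t <= 1.
Proof.
apply: le_trans (tree_sum_le1 (tree_size t)); apply: le_tree_sum.
exact: gw_weight_ge0.
Qed.

(** If h destroys the weight D in size k.+1, then z phi(1) - D z ^ k.+1 is still at
    most 1 for z <= 1 + D, so 1 remains a supersolution beyond the critical
    point z = 1. The damping starts to act at size k.+1; the hypothesis on
    z ^ k.+1 takes care of the smaller sizes. *)
Lemma damped_gf_le1 h k z : (forall u, 0 <= h u) ->
  (forall u, tree_size u != k.+1 -> h u = 1) -> 1 <= z ->
  z <= 1 + (a k.+1 - tree_sum (local_weight p h) k.+1) ->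
  z ^+ k.+1 * (1 - a k.+1) <= 1 ->
  forall n, tree_gf (local_weight p h) n z <= 1.
Proof.
move=> h0 h1 z1 zd zk; have z0 : 0 <= z by lra.
have W0 := gw_weight_ge0.
elim=> [|n IHn]; first by rewrite /tree_gf big_ord_recl big_ord0 tree_sum0 mul0r addr0.
have [kn|nk] := leqP k n; last first.
  have -> : tree_gf (local_weight p h) n.+1 z = tree_gf W n.+1 z.
    apply: eq_bigr => i _; congr (_ * _); apply: eq_big_seq => t.
    rewrite mem_trees => /eqP ti; apply: (local_weight_small p h k.+1) => //.
    by rewrite ti (leq_trans (ltn_ord i)).
  apply: le_trans zk; have := tree_sum_total_le1 k.+1; rewrite big_ord_recr /=.
  rewrite -lerBrDr => ak; apply: le_trans (ler_wpM2l _ ak); last exact: exprn_ge0.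
  rewrite mulr_sumr; apply: le_trans (tree_gf_mono W z n.+1 k _ _ _) _ => //.
  apply: ler_sum => i _; rewrite mulrC ler_wpM2r ?tree_sum_ge0 //.
  by apply: ler_weXn2l => //; exact/ltnW.
apply: le_trans (tree_gf_functional_le h k n z h0 h1 z0) _; rewrite kn.
set b := local_weight p h; set D := a k.+1 - tree_sum b k.+1.
have b0 t : 0 <= b t by exact: local_weight_ge0.
have S1 : \sum_(m < n.+1) p m * tree_gf b n z ^+ m <= 1.
  apply: le_trans (sum_p_le1 n.+1); apply: ler_sum => m _.
  by rewrite ler_piMr // exprn_ile1 // tree_gf_ge0.
have D0 : 0 <= D by rewrite /D /b; lra.
have zk1 : 1 <= z ^+ k.+1 by apply: exprn_ege1.
have : z * (\sum_(m < n.+1) p m * tree_gf b n z ^+ m) <= z by rewrite ler_piMr.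
have : D <= D * z ^+ k.+1 by rewrite ler_peMr.
by rewrite -/b -/D in zd; lra.
Qed.

(** The other half of F = z phi(F): products of fewer than M truncated generating
    functions only involve trees of size at most M * N + 1. *)
Lemma tree_gf_functional_ge M N z : 0 <= z ->
  z * (\sum_(m < M) p m * tree_gf W N z ^+ m) <= tree_gf W (M * N).+1 z.
Proof.
move=> z0; have W0 := gw_weight_ge0.
set P := \poly_(i < N.+1) a i.
rewrite tree_gfS ler_wpM2l //.
have Pm m : (m < M)%N -> tree_gf W N z ^+ m = \sum_(j < (M * N).+1) (P ^+ m)`_j * z ^+ j.
  move=> mM; rewrite tree_gf_poly -/P -horner_exp; apply: horner_coef_wide.
  apply: leq_trans (size_poly_exp_leq _ _) _.
  have : (size P <= N.+1)%N by exact: size_poly.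
  case: (size P) => [|s] /=; first by rewrite mul0n.
  by rewrite !ltnS mulnC => sN; rewrite leq_mul // ltnW.
under eq_bigr => m _ do rewrite Pm // mulr_sumr.
rewrite exchange_big /=; apply: ler_sum => j _.
under eq_bigr do rewrite mulrA.
rewrite -mulr_suml ler_wpM2r ?exprn_ge0 //.
rewrite (tree_sum_rec p (fun=> 1) j (maxn M j.+1)) ?leq_maxr //.
apply: (@le_trans _ _ (\sum_(m < M) p m * forest_sum W m j)).
  apply: ler_sum => m _; apply: ler_wpM2l; first exact/ltW.
  rewrite -(forest_sum_coef W m j (\poly_(i < (maxn N j).+1) a i)); last first.
    by move=> i ij; rewrite coef_poly ltnS leq_max ij orbT.
  have PQ i : 0 <= P`_i <= (\poly_(i < (maxn N j).+1) a i)`_i.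
    rewrite !coef_poly !ltnS leq_max; case: (leqP i N) => /= _.
      by rewrite lexx andbT; exact: tree_sum_ge0.
    by case: ifP; rewrite lexx //= tree_sum_ge0.
  by case/andP: (coef_exp_le P _ m j PQ).
rewrite -!(big_mkord xpredT (fun m => p m * forest_sum W m j)).
rewrite [leRHS](big_cat_nat (n := M)) ?leq_maxl //= lerDl sumr_ge0 // => m _.
rewrite mulr_ge0 //; apply: sumr_ge0 => s _; exact: prodr_ge0.
Qed.

End generating_function.

(** * Resampling the fringe subtrees of a given size *)

Lemma bernoulli_ge {R : realFieldType} m (x : R) :
  x <= 1 -> 1 - m%:R * x <= (1 - x) ^+ m.
Proof.
move=> x1; elim: m => [|m IHm]; first by rewrite mul0r subr0.
rewrite exprS; apply: le_trans (ler_wpM2l _ IHm); last by lra.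
have : 0 <= m%:R * x ^+ 2 by rewrite mulr_ge0 ?sqr_ge0.
by rewrite -[m.+1]addn1 natrD expr2; lra.
Qed.

Section resampling_bounds.
Context {R : realType}.
Variable p : nat -> R.
Hypothesis p_gt0 : forall i, 0 < p i.
Hypothesis sum_p_le1 : forall n, \sum_(i < n) p i <= 1.

Local Notation W := (gw_weight p).
Local Notation a := (tree_sum W).
Let W_gt0 := gw_weight_gt0 p p_gt0.
Let W_ge0 := gw_weight_ge0 p p_gt0.

Local Notation occurrences T t := (count_mem T (fringe_subtrees t)).

Lemma occurrences_le_size T t : (occurrences T t <= tree_size t)%N.
Proof. by rewrite -size_fringe_subtrees count_size. Qed.

Definition two_point (T T' : plane_tree) (lam mu : R) (u : plane_tree) : R :=
  if u == T then lam else if u == T' then mu else 1.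

Lemma prod_two_point T T' lam mu l : T != T' ->
  \prod_(u <- l) two_point T T' lam mu u =
  lam ^+ count_mem T l * mu ^+ count_mem T' l.
Proof.
move=> TT'; elim: l => [|u l IHl]; first by rewrite big_nil mulr1.
rewrite big_cons IHl /two_point /=.
have [->|uT] := eqVneq u T; first by rewrite (negbTE TT') add0n add1n exprS mulrA.
by case: eqP => _; rewrite !(add0n, add1n) ?mul1r // exprS mulrCA.
Qed.

Lemma sum_two_point T T' lam mu k : T != T' ->
  tree_size T = k -> tree_size T' = k ->
  \sum_(t <- trees k) two_point T T' lam mu t * W t =
  a k + ((lam - 1) * W T + (mu - 1) * W T').
Proof.
move=> TT' Tk T'k.
have pick U : tree_size U = k -> 
    \sum_(t <- trees k) (if t == U then W t else 0) = W U.
  move=> Uk; rewrite -big_mkcond -big_filter filter_pred1_uniq ?trees_uniq //.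
    by rewrite big_seq1.
  by rewrite mem_trees Uk.
rewrite -(pick T) // -(pick T') // /tree_sum !mulr_sumr -!big_split /=.
apply: eq_bigr => t _; rewrite /two_point; have [->|tT] := eqVneq t T.
  by rewrite (negbTE TT'); ring.
by case: eqP => _; ring.
Qed.

Lemma two_point_off T T' lam mu k : tree_size T = k -> tree_size T' = k ->
  forall u, tree_size u != k -> two_point T T' lam mu u = 1.
Proof.
move=> Tk T'k u uk; rewrite /two_point.
have [uT|_] := eqVneq u T; first by rewrite uT Tk eqxx in uk.
by have [uT'|//] := eqVneq u T'; rewrite uT' T'k eqxx in uk.
Qed.

(** The numbers of copies of T and T' in a conditioned tree have a joint
    generating function equal to 1 along the line where lam and mu preserve the
    total weight of the two trees. *)
Lemma two_point_resampling T T' lam mu n : T != T' ->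
  tree_size T = tree_size T' -> (lam - 1) * W T = (1 - mu) * W T' ->
  \sum_(t <- trees n) W t * (lam ^+ occurrences T t * mu ^+ occurrences T' t) = a n.
Proof.
move=> TT' Tk bal.
rewrite -(local_weight_resampling p (two_point T T' lam mu) (tree_size T')).
- by apply: eq_bigr => t _; rewrite local_weight_fringe prod_two_point.
- exact: two_point_off.
- by rewrite sum_two_point // bal; rewrite -/W /tree_sum; ring.
Qed.

(** Exchanging T and T' shows that the expected numbers of their copies are in
    the ratio W T / W T', and T' has at most n copies. Here this is read off from
    the joint generating function with mu so close to 1 that mu ^ n >= 1 / 2. *)
Lemma sum_containing_le T T' n : tree_size T = tree_size T' -> (0 < n)%N ->
  \sum_(t <- trees n | T \in fringe_subtrees t) W t <=
  4 * n%:R * (W T / W T') * a n.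
Proof.
move=> TT' n0; have n1 : 1 <= n%:R :> R by rewrite ler1n.
have W_T := W_gt0 T; have W_T' := W_gt0 T'.
have an : 0 < a n by exact: tree_sum_gt0.
have [<-|neq] := eqVneq T T'.
  rewrite divff ?gt_eqF // mulr1; apply: (@le_trans _ _ (a n)).
    by rewrite [leRHS](bigID (fun t => T \in fringe_subtrees t)) /= lerDl sumr_ge0.
  by rewrite ler_peMl ?ltW //; nra.
have nN0 : n%:R != 0 :> R by rewrite pnatr_eq0 -lt0n.
(* mu = 1 - x, and lam is determined by the balance condition. *)
pose x : R := (2 * n%:R)^-1; pose lam := 1 + x * (W T' / W T).
have xn : n%:R * x = 1 / 2 by rewrite /x; field.
have x0 : 0 < x by rewrite invr_gt0; lra.
have lam1 : 1 <= lam by rewrite lerDl mulr_ge0 ?divr_ge0 ?W_ge0 // ltW.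
have bal : (lam - 1) * W T = (1 - (1 - x)) * W T'.
  by rewrite /lam; field; rewrite gt_eqF.
set S := \sum_(t <- _ | _) _.
have lamS : lam / 2 * S <= a n.
  rewrite -(two_point_resampling T T' lam (1 - x) n neq TT' bal).
  rewrite [leRHS](bigID (fun t => T \in fringe_subtrees t)) /=.
  apply: (@le_trans _ _ (\sum_(t <- trees n | T \in fringe_subtrees t)
      W t * (lam ^+ occurrences T t * (1 - x) ^+ occurrences T' t))); last first.
    rewrite lerDl sumr_ge0 // => t _; rewrite !mulr_ge0 ?W_ge0 ?exprn_ge0 //; nra.
  rewrite mulr_sumr big_seq_cond [leRHS]big_seq_cond; apply: ler_sum => t.
  rewrite mem_trees => /andP[/eqP tn Tt]; rewrite mulrC ler_wpM2l ?W_ge0 //.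
  have Z0 : (0 < occurrences T t)%N by rewrite -has_count has_pred1.
  have lamZ : lam <= lam ^+ occurrences T t by rewrite ler_eXnr.
  have muY : 1 / 2 <= (1 - x) ^+ occurrences T' t.
    apply: (@le_trans _ _ (1 - n%:R * x)); first by lra.
    apply: le_trans (bernoulli_ge n _ _) _; first by nra.
    by apply: ler_wiXn2l; rewrite -?tn ?occurrences_le_size //; nra.
  by apply: ler_pM => //; lra.
have : x * (W T' / W T) / 2 * S <= a n.
  apply: le_trans lamS; rewrite ler_wpM2r ?sumr_ge0 // /lam; lra.
have c0 : 0 < 4 * n%:R * (W T / W T') by rewrite !mulr_gt0 ?invr_gt0 //; lra.
rewrite -(ler_pM2l c0); congr (_ <= _).
by rewrite /x; field; rewrite nN0 !gt_eqF.
Qed.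

End resampling_bounds.

Section containment_bounds.
Context {R : realType}.
Variable p : nat -> R.
Hypothesis p_gt0 : forall i, 0 < p i.
Hypothesis sum_p_le1 : forall n, \sum_(i < n) p i <= 1.

Local Notation W := (gw_weight p).
Local Notation a := (tree_sum W).
Let W_gt0 := gw_weight_gt0 p p_gt0.
Let W_ge0 := gw_weight_ge0 p p_gt0.
Let W_le1 := gw_weight_le1 p p_gt0 sum_p_le1.

Local Notation occurrences T t := (count_mem T (fringe_subtrees t)).

(** Every copy of T' might as well have been a copy of T: a ban on T (lam = 0)
    is compensated by a gain of 1 + W T / W T' for every copy of T'. *)
Lemma sum_avoiding_le T T' n y : T != T' -> tree_size T = tree_size T' ->
  (\sum_(t <- trees n | (T \notin fringe_subtrees t) &&
                        (y <= occurrences T' t)%N) W t) *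
  (1 + W T / W T') ^+ y <= a n.
Proof.
move=> TT' Tk; set mu := 1 + W T / W T'.
have mu1 : 1 <= mu by rewrite lerDl divr_ge0.
have bal : (0 - 1) * W T = (1 - mu) * W T'.
  by rewrite /mu; field; rewrite gt_eqF.
rewrite -(two_point_resampling p T T' 0 mu n TT' Tk bal).
rewrite [leRHS](bigID (fun t => (T \notin fringe_subtrees t) &&
                                 (y <= occurrences T' t)%N)) /=.
rewrite -[leLHS]addr0 lerD //; last first.
  apply: sumr_ge0 => t _; rewrite mulr_ge0 // mulr_ge0 // exprn_ge0 //; lra.
rewrite mulr_suml; apply: ler_sum => t /andP[Tt yt].
rewrite ler_wpM2l //.
have -> : occurrences T t = 0%N by apply/count_memPn.
by rewrite expr0 mul1r; apply: ler_weXn2l.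
Qed.

(** Both factors are compared with exponentials: (1 + x) ^ k <= exp y and
    1 - y <= exp (- y). *)
Lemma one_plus_pow_le (x y : R) k : 0 <= x -> k%:R * x <= y ->
  (1 + x) ^+ k * (1 - y) <= 1.
Proof.
move=> x0 kxy; have [y1|y1] := leP 1 y.
  apply: (@le_trans _ _ 0) => //; apply: mulr_ge0_le0; last by lra.
  by rewrite exprn_ge0 //; lra.
apply: (@le_trans _ _ (expR y * expR (- y))); last first.
  by rewrite -expRD subrr expR0.
apply: ler_pM; [by rewrite exprn_ge0 //; lra | by lra | | ].
  apply: (@le_trans _ _ (expR x ^+ k)).
    by apply: lerXn2r; rewrite ?nnegrE ?expR_ge0 ?expR_ge1Dx //; lra.
  by rewrite -expRM_natl ler_expR.
by have := expR_ge1Dx (- y); lra.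
Qed.

(** Halving the weight of T costs at most 2 ^ y on the trees with fewer than y
    copies of T, and makes the generating function bounded by 1 at a point beyond
    1; so the trees of size n with few copies carry an exponentially small
    weight. *)
Lemma sum_few_le T n y :
  \sum_(t <- trees n | (occurrences T t < y)%N) W t <=
  2 ^+ y * (1 + W T / (2 * (tree_size T)%:R)) ^- n.
Proof.
have [k Tk] : exists k, tree_size T = k.+1 by case: T => s; eexists.
pose h (u : plane_tree) : R := if u == T then 2^-1 else 1.
set z := 1 + _.
have k1 : 1 <= k.+1%:R :> R by rewrite ler1n.
have h0 u : 0 <= h u by rewrite /h; case: ifP => _; lra.
have h1 u : tree_size u != k.+1 -> h u = 1.
  by rewrite /h; have [->|//] := eqVneq u T; rewrite Tk eqxx.
have hW t : local_weight p h t = W t * 2^-1 ^+ occurrences T t.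
  rewrite local_weight_fringe; congr (_ * _).
  elim: (fringe_subtrees t) => [|u l IHl]; first by rewrite big_nil.
  rewrite big_cons IHl /h /=; have [_|_] := eqVneq u T; last by rewrite add0n mul1r.
  by rewrite add1n exprS.
have defect : a k.+1 - tree_sum (local_weight p h) k.+1 = W T / 2.
  rewrite (tree_sum_local_at p h k.+1 h1) /tree_sum -sumrB.
  rewrite (bigD1_seq T) ?trees_uniq ?mem_trees ?Tk //.
  rewrite big1 /=; first by rewrite /h eqxx; lra.
  by move=> t tT; rewrite /h (negbTE tT); ring.
have x0 : 0 <= W T / (2 * (tree_size T)%:R) by rewrite divr_ge0 // mulr_ge0.
have z1 : 1 <= z by rewrite lerDl.
have kx : k.+1%:R * (W T / (2 * (tree_size T)%:R)) = W T / 2.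
  by rewrite Tk; field; rewrite gt_eqF //; lra.
have WT := W_gt0 T.
have gf1 : tree_gf (local_weight p h) n z <= 1.
  apply: (damped_gf_le1 p p_gt0 sum_p_le1 h k z h0 h1 z1).
    by rewrite defect lerD2l; nra.
  apply: one_plus_pow_le => //; rewrite kx.
  by have := le_tree_sum W T W_ge0; rewrite Tk; lra.
have zn : 0 < z ^+ n by rewrite exprn_gt0 //; lra.
rewrite ler_pdivlMr //.
apply: (@le_trans _ _ (2 ^+ y * tree_gf (local_weight p h) n z)); last first.
  by rewrite ler_piMr // exprn_ge0.
rewrite /tree_gf big_ord_recr /= mulrDr.
apply: (@le_trans _ _ (2 ^+ y * (tree_sum (local_weight p h) n * z ^+ n))); last first.
  rewrite lerDr mulr_ge0 ?exprn_ge0 //; apply: sumr_ge0 => i _.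
  rewrite mulr_ge0 ?exprn_ge0 ?tree_sum_ge0 //; last by lra.
  by move=> t; exact: local_weight_ge0.
rewrite mulrA; apply: ler_wpM2r; first exact: ltW.
rewrite /tree_sum mulr_sumr [leRHS](bigID (fun t => (occurrences T t < y)%N)) /=.
rewrite -[leLHS]addr0 lerD //; last first.
  apply: sumr_ge0 => t _; rewrite mulr_ge0 ?exprn_ge0 //; exact: local_weight_ge0.
apply: ler_sum => t yt; rewrite hW mulrCA ler_peMr //.
rewrite exprVn ler_pdivlMr ?exprn_gt0 // mul1r.
by apply: ler_weXn2l; [lra | exact: ltnW].
Qed.

(** Either the path of size k has fewer than y copies, or each of these copies
    is a chance for the missing tree. *)
Lemma sum_missing_le k n y (q : R) : (0 < k)%N -> 0 <= q ->
  (forall T, tree_size T = k -> q <= W T) ->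
  \sum_(t <- trees n | has (fun T => T \notin fringe_subtrees t) (trees k)) W t <=
  2 ^+ y * (1 + W (path_tree k) / (2 * k%:R)) ^- n +
  (size (trees k))%:R * (1 + q) ^- y * a n.
Proof.
move=> k0 q0 qW; set U := path_tree k.
have Uk : tree_size U = k by exact: path_tree_size.
have few := sum_few_le U n y; rewrite Uk in few.
rewrite (bigID (fun t => (occurrences U t < y)%N)) /= lerD //.
  apply: le_trans few; rewrite [leRHS]big_mkcond [leLHS]big_mkcond.
  by apply: ler_sum => t _; case: has; case: ltnP => //=.
have avoid T : T \in trees k ->
    \sum_(t <- trees n | (T \notin fringe_subtrees t) && (y <= occurrences U t)%N) W t
    <= (1 + q) ^- y * a n.
  rewrite mem_trees => /eqP Tk; rewrite mulrC ler_pdivlMr; last first.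
    by rewrite exprn_gt0 //; lra.
  have [TU|TU] := eqVneq T U.
    have [->|y0] := posnP y.
      rewrite expr0 mulr1 [leRHS](bigID (fun t =>
        (T \notin fringe_subtrees t) && (0 <= occurrences U t)%N)) /=.
      by rewrite lerDl sumr_ge0.
    rewrite big_pred0 ?mul0r ?tree_sum_ge0 // => t; rewrite TU.
    apply/negbTE/negP => /andP[/negP Ut /(leq_trans y0)].
    by rewrite -has_count has_pred1.
  apply: le_trans (sum_avoiding_le T U n y TU _); last by rewrite Tk Uk.
  rewrite ler_wpM2l ?sumr_ge0 //; apply: lerXn2r; rewrite ?nnegrE.
  - by lra.
  - by rewrite addr_ge0 ?divr_ge0.
  - rewrite lerD2l ler_pdivlMr //; apply: le_trans (qW T Tk).
    by rewrite ler_piMr.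
apply: (@le_trans _ _ (\sum_(T <- trees k) (1 + q) ^- y * a n)); last first.
  by rewrite big_const_seq count_predT iter_addr_0 -mulrA mulr_natl.
apply: le_trans (_ : \sum_(T <- trees k) _ <= _); last first.
  by rewrite big_seq [leRHS]big_seq; apply: ler_sum avoid.
rewrite (exchange_big_dep xpredT) //= big_mkcond; apply: ler_sum => t _.
case: ifPn => [/andP[/hasP[T Tk Tt] ty]|_]; last exact: sumr_ge0.
rewrite -leqNgt in ty; rewrite (big_rem T) //= Tt ty /= lerDl.
by apply: sumr_ge0.
Qed.

End containment_bounds.

(** * The tail of the total progeny *)

(** The exact second-order coefficient would be m (m - 1) / 2; the larger
    (m - 1) ^ 2 averages to the variance when the mean is 1. *)
Lemma pow_1sub_le {R : realFieldType} m (u : R) : 0 <= u <= 1 ->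
  (1 - u) ^+ m <= 1 - m%:R * u + (m%:R - 1) ^+ 2 * u ^+ 2.
Proof.
move=> /andP[u0 u1].
case: m => [|m]; first by rewrite expr0; have := sqr_ge0 u; nra.
elim: m => [|m IHm]; first by rewrite expr1; lra.
rewrite exprS; have u1' : 0 <= 1 - u by lra.
apply: le_trans (ler_wpM2l u1' IHm) _.
rewrite -[m.+2%:R]natr1.
have m0 : 0 <= m%:R :> R by [].
rewrite -[m.+1%:R]natr1 -subr_ge0.
set y := m%:R in m0 *.
rewrite (_ : _ - _ = u ^+ 2 * (y + y ^+ 2 * u)); last by ring.
by rewrite mulr_ge0 ?sqr_ge0 // addr_ge0 // mulr_ge0 // sqr_ge0.
Qed.

Section tail_of_total_progeny.
Context {R : realType}.
Variable p : nat -> R.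
Hypothesis p_gt0 : forall i, 0 < p i.
Hypothesis p_total : \sum_(i < n) p i @[n --> \oo] --> (1 : R).
Hypothesis p_mean : \sum_(i < n) i%:R * p i @[n --> \oo] --> (1 : R).
Variable v : R.
Hypothesis p_second_moment : forall n, \sum_(i < n) (i%:R - 1) ^+ 2 * p i <= v.

Local Notation W := (gw_weight p).
Local Notation a := (tree_sum W).
Let W_gt0 := gw_weight_gt0 p p_gt0.
Let W_ge0 := gw_weight_ge0 p p_gt0.
Let p_ge0 i : 0 <= p i. Proof. exact: ltW. Qed.

Lemma partial_sums_le (u : nat -> R) (l : R) n : (forall i, 0 <= u i) ->
  \sum_(i < n) u i @[n --> \oo] --> l -> \sum_(i < n) u i <= l.
Proof.
move=> u0 ul; rewrite -(cvg_lim _ ul) //.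
apply: (@nondecreasing_cvgn_le _ (fun n => \sum_(i < n) u i)).
  by apply/nondecreasing_seqP => k; rewrite big_ord_recr /= lerDl.
by apply/cvg_ex; exists l.
Qed.

Lemma pmf_partial_sum_le1 n : \sum_(i < n) p i <= 1.
Proof. exact: partial_sums_le. Qed.

Lemma pmf_partial_mean_le1 n : \sum_(i < n) i%:R * p i <= 1.
Proof.
by apply: (partial_sums_le (fun i => i%:R * p i) 1 n _ p_mean) => i; rewrite mulr_ge0.
Qed.

Let P1 := pmf_partial_sum_le1.

Lemma second_moment_ge0 : 0 <= v.
Proof. by have := p_second_moment 0; rewrite big_ord0. Qed.

(** Here the mean enters in the direction that truncation loses, whence the
    passage to the limit. *)
Lemma offspring_gf_le M u : 0 <= u <= 1 ->
  \sum_(m < M) p m * (1 - u) ^+ m <= 1 - u + v * u ^+ 2.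
Proof.
move=> u01; have /andP[u0 u1] := u01.
have lim : \sum_(i < n) p i - u * \sum_(i < n) i%:R * p i + v * u ^+ 2
           @[n --> \oo] --> 1 - u * 1 + v * u ^+ 2.
  apply: cvgD; last exact: cvg_cst.
  by apply: cvgB => //; apply: cvgMr.
rewrite mulr1 in lim; rewrite -(cvg_lim _ lim) //.
apply: limr_ge; first by apply/cvg_ex; eexists; exact: lim.
near=> n; apply: (@le_trans _ _ (\sum_(m < n) p m * (1 - u) ^+ m)).
  have Mn : (M <= n)%N by near: n; exact: nbhs_infty_ge.
  rewrite -!(big_mkord xpredT (fun m => p m * (1 - u) ^+ m)).
  rewrite [leRHS](big_cat_nat (n := M)) //= lerDl sumr_ge0 // => m _.
  by rewrite mulr_ge0 ?exprn_ge0 //; lra.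
apply: (@le_trans _ _ (\sum_(m < n) p m * (1 - m%:R * u + (m%:R - 1) ^+ 2 * u ^+ 2))).
  by apply: ler_sum => m _; apply: ler_wpM2l => //; exact: pow_1sub_le.
rewrite (_ : \sum_(m < n) _ = \sum_(i < n) p i - u * (\sum_(i < n) i%:R * p i) +
    (\sum_(i < n) (i%:R - 1) ^+ 2 * p i) * u ^+ 2).
  by rewrite lerD2l ler_wpM2r ?sqr_ge0.
rewrite mulr_sumr mulr_suml -sumrB -big_split /=; apply: eq_bigr => m _.
by ring.
Unshelve. all: by end_near. Qed.

(** Bernoulli's inequality is used for every m but 2, which supplies the
    quadratic term. *)
Lemma offspring_gf_ge M u : 0 <= u <= 1 -> (2 < M)%N ->
  \sum_(m < M) p m - u + p 2 * u ^+ 2 <= \sum_(m < M) p m * (1 - u) ^+ m.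
Proof.
move=> /andP[u0 u1] M2.
apply: (@le_trans _ _ (\sum_(m < M) p m - u * (\sum_(m < M) m%:R * p m) + p 2 * u ^+ 2)).
  by rewrite lerD2r lerD2l lerN2 ler_piMr // pmf_partial_mean_le1.
have -> : p 2 * u ^+ 2 = \sum_(m < M) (if m == Ordinal M2 then p m * u ^+ 2 else 0).
  by rewrite -big_mkcond big_pred1_eq.
rewrite mulr_sumr -sumrB -big_split /=; apply: ler_sum => m _.
case: eqP => [->|_] /=; first by lra.
rewrite addr0 (_ : _ - _ = p m * (1 - m%:R * u)); last by ring.
by rewrite ler_wpM2l // bernoulli_ge.
Qed.

Let gf01 n z : 0 <= z <= 1 -> 0 <= 1 - tree_gf W n z <= 1.
Proof.
move=> z01; have /andP[z0 _] := z01.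
have := tree_gf_le1 p p_gt0 P1 n z z01; have := tree_gf_ge0 W n z W_ge0 z0.
by move=> ? ?; lra.
Qed.

(** With u = 1 - F(z), the functional equation reads
    (1 - z) (1 - u) = z (phi(1 - u) - (1 - u)). Mean 1 cancels the linear term of
    the right-hand side and the variance bounds the quadratic one, so u is at
    least of order sqrt (1 - z). *)
Lemma tree_gf_deficit_ge n z : 0 <= z <= 1 ->
  1 - z <= (2 * v + 4) * (1 - tree_gf W n z) ^+ 2.
Proof.
move=> z01; have /andP[z0 z1] := z01; have v0 := second_moment_ge0.
set u := 1 - tree_gf W n z; have u01 : 0 <= u <= 1 by exact: gf01.
have /andP[u0 u1] := u01.
have key : 1 - u <= z * (1 - u + v * u ^+ 2).
  apply: le_trans (ler_wpM2l z0 (offspring_gf_le n.+1 u u01)).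
  have := tree_gf_functional_le p p_gt0 (fun=> 1) n n z (fun=> ler01)
    (fun _ _ => erefl) z0.
  rewrite -/W subrr mul0r if_same subr0 /u subKr; apply: le_trans.
  exact: tree_gf_mono.
have u20 := sqr_ge0 u.
have [uh|uh] := leP u (1 / 2).
  have : 0 <= (1 - z) * (v * u ^+ 2) by rewrite !mulr_ge0 //; lra.
  have : 0 <= (1 - z) * (1 / 2 - u) by rewrite mulr_ge0 //; lra.
  have : 0 <= v * u ^+ 2 by rewrite mulr_ge0.
  by nra.
have : 0 <= v * u ^+ 2 by rewrite mulr_ge0.
by nra.
Qed.

(** The quadratic term of phi(1 - u) - (1 - u) is at least p 2 * u ^ 2, so u is
    at most of order sqrt (1 - z). The supremum F of the truncations replaces the
    limit. *)
Lemma tree_gf_limit_deficit_le z (F := sup [set tree_gf W n z | n in setT]) :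
  1 / 2 <= z <= 1 -> F <= 1 /\ (1 - F) ^+ 2 <= 2 / p 2 * (1 - z).
Proof.
move=> /andP[z2 z1]; have z0 : 0 <= z by lra.
have z01 : 0 <= z <= 1 by rewrite z0.
have ub1 : ubound [set tree_gf W n z | n in setT] 1.
  by move=> _ [n _ <-]; exact: tree_gf_le1.
have hs : has_sup [set tree_gf W n z | n in setT].
  by split; [exists (tree_gf W 0 z); exists 0 | exists 1].
have leF n : tree_gf W n z <= F by apply: ub_le_sup; [exists 1 | exists n].
have F1 : F <= 1 by apply: ge_sup => //; exact: hs.1.
split => //; set u := 1 - F.
have p2 : 0 < p 2 by [].
have step n : tree_gf W n z <= F / z - p 2 * u ^+ 2.
  set un := 1 - tree_gf W n z.
  have un01 : 0 <= un <= 1 by exact: gf01.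
  have uun : p 2 * u ^+ 2 <= p 2 * un ^+ 2.
    apply: ler_wpM2l => //; have := leF n; rewrite /u /un => leFn.
    by apply: lerXn2r; rewrite ?nnegrE; lra.
  have bound M : \sum_(i < M) p i <= F / z + un - p 2 * u ^+ 2.
    have big : \sum_(i < maxn M 3) p i <= F / z + un - p 2 * u ^+ 2.
      have zF : \sum_(m < maxn M 3) p m * (1 - un) ^+ m <= F / z.
        rewrite ler_pdivlMr; last by lra.
        rewrite mulrC /un subKr; apply: le_trans (leF (maxn M 3 * n).+1).
        exact: tree_gf_functional_ge.
      have := offspring_gf_ge (maxn M 3) un un01 (leq_maxr _ _).
      by move=> ?; lra.
    apply: le_trans big.
    rewrite -!(big_mkord xpredT p) [leRHS](big_cat_nat (n := M)) ?leq_maxl //=.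
    by rewrite lerDl sumr_ge0.
  have : 1 <= F / z + un - p 2 * u ^+ 2.
    rewrite -(cvg_lim _ p_total) //; apply: limr_le; first by apply/cvg_ex; exists 1.
    exact: nearW.
  by rewrite /un; lra.
have FF : F <= F / z - p 2 * u ^+ 2.
  apply: ge_sup; first exact: hs.1.
  by move=> _ [n _ <-].
have zp : 0 < z by lra.
have FF' : p 2 * u ^+ 2 * z <= F * (1 - z).
  have : z * F <= z * (F / z - p 2 * u ^+ 2) by rewrite ler_wpM2l.
  by rewrite mulrBr mulrCA divff ?gt_eqF // mulr1; lra.
have : F * (1 - z) <= 1 - z by rewrite ler_piMl //; lra.
have : p 2 * u ^+ 2 * (1 / 2) <= p 2 * u ^+ 2 * z.
  by rewrite ler_wpM2l // mulr_ge0 // sqr_ge0.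
move=> A B; have C : p 2 * u ^+ 2 <= 2 * (1 - z) by lra.
by rewrite mulrAC ler_pdivlMr // mulrC.
Qed.

End tail_of_total_progeny.

(** * A lower bound on the probability of every size *)

Section subexponential_lower_bound.
Context {R : realType}.
Variable p : nat -> R.
Hypothesis p_gt0 : forall i, 0 < p i.
Hypothesis p_total : \sum_(i < n) p i @[n --> \oo] --> (1 : R).
Hypothesis p_mean : \sum_(i < n) i%:R * p i @[n --> \oo] --> (1 : R).
Variable v : R.
Hypothesis p_second_moment : forall n, \sum_(i < n) (i%:R - 1) ^+ 2 * p i <= v.

Local Notation W := (gw_weight p).
Local Notation a := (tree_sum W).
Let W_ge0 := gw_weight_ge0 p p_gt0.
Let p_ge0 i : 0 <= p i. Proof. exact: ltW. Qed.
Let P1 := pmf_partial_sum_le1 p p_gt0 p_total.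
Let a_ge0 n : 0 <= a n. Proof. exact: tree_sum_ge0. Qed.

Let C : R := 2 * v + 4.
Let C_ge4 : 4 <= C.
Proof. by have := second_moment_ge0 p v p_second_moment; rewrite /C; lra. Qed.

(** At z = 1 - s the sizes below x account for a deficit of at most s * x. For s a
    small multiple of x ^ - 2 this is less than the total deficit, of order
    sqrt s, and the difference must come from the tail. *)
Lemma progeny_tail_ge x : (0 < x)%N ->
  \sum_(i < x) a i <= 1 - (4 * C * x%:R)^-1.
Proof.
case: x => // x _; set X : R := x.+1%:R; have X1 : 1 <= X by rewrite ler1n.
have C4 := C_ge4.
set e := (4 * C * X)^-1.
have e0 : 0 < e by rewrite invr_gt0 !mulr_gt0 //; lra.
have eCX : e * (C * X) = 1 / 4 by rewrite /e; field; rewrite !gt_eqF //; lra.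
(* s = 1 / (4 C X ^ 2), so that C (2 e) ^ 2 = s and the deficit is at least 2 e. *)
pose s := e / X; have sX : s * X = e by rewrite /s mulfVK // gt_eqF //; lra.
have s0 : 0 < s by rewrite divr_gt0 //; lra.
have Cs : C * (2 * e) ^+ 2 = s.
  by rewrite /s /e; field; rewrite !gt_eqF //; lra.
have s1 : s <= 1.
  by have : s <= s * X; [rewrite ler_peMr // ltW | nra].
have z01 : 0 <= 1 - s <= 1 by lra.
have := tree_gf_deficit_ge p p_gt0 p_total p_mean v p_second_moment x (1 - s) z01.
rewrite subKr -/C => sC; have /andP[g0 g1] : 0 <= 1 - tree_gf W x (1 - s) <= 1.
  have /andP[z0 z1] := z01.
  have := tree_gf_le1 p p_gt0 P1 x _ z01; have := tree_gf_ge0 W x _ W_ge0 z0.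
  by move=> ? ?; lra.
have d2e : 2 * e <= 1 - tree_gf W x (1 - s).
  rewrite -(@ler_pXn2r _ 2) ?nnegrE //; last by lra.
  by rewrite -(@ler_pM2l _ C) ?Cs //; lra.
have T1 : \sum_(i < x.+1) a i <= 1 by apply: tree_sum_total_le1.
suff : (1 - e) * \sum_(i < x.+1) a i <= tree_gf W x (1 - s).
  have : e * \sum_(i < x.+1) a i <= e by rewrite ler_piMr // ltW.
  by move=> ? ?; lra.
rewrite mulr_sumr; apply: ler_sum => i _; rewrite mulrC ler_wpM2l //.
apply: le_trans (bernoulli_ge i s s1); rewrite lerD2l lerN2 -sX mulrC.
by rewrite ler_wpM2l ?ler_nat 1?ltnW // ltW.
Qed.

(** At z = 1 - 1 / X every size from X on loses at least half of its weight, so the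
    tail is at most twice the deficit. *)
Lemma progeny_tail_le X : (1 < X)%N ->
  (1 - \sum_(i < X) a i) ^+ 2 <= 8 / p 2 / X%:R.
Proof.
move=> X1; have X2 : 2 <= X%:R :> R by rewrite ler_nat.
set s : R := X%:R^-1.
have s0 : 0 < s by rewrite invr_gt0; lra.
have sX : s * X%:R = 1 by rewrite mulVf // gt_eqF //; lra.
have s2 : s <= 1 / 2 by nra.
have z01 : 1 / 2 <= 1 - s <= 1 by lra.
have [F1] := tree_gf_limit_deficit_le p p_gt0 p_total p_mean (1 - s) z01.
set F := sup _ in F1 *; rewrite subKr => Fs.
set t := \sum_(i < X) a i.
have t1 : t <= 1 by rewrite /t; case: (X) X1 => // x _; apply: tree_sum_total_le1.
have zX : (1 - s) ^+ X <= 1 / 2.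
  have e2 : 2 <= expR 1 :> R by have := expR_ge1Dx (1 : R); lra.
  apply: (@le_trans _ _ (expR (- 1))).
    apply: (@le_trans _ _ (expR (- s) ^+ X)).
      apply: lerXn2r; rewrite ?nnegrE ?expR_ge0 //; first by lra.
      by have := expR_ge1Dx (- s); lra.
    by rewrite -expRM_natl mulrN mulrC sX.
  rewrite expRN div1r lef_pV2 ?posrE ?expR_gt0 //.
have tF : F <= t + (1 - s) ^+ X * (1 - t).
  apply: ge_sup; first by exists (tree_gf W 0 (1 - s)); exists 0.
  move=> _ [n _ <-].
  have [z0 z1] : 0 <= 1 - s /\ 1 - s <= 1 by split; lra.
  apply: le_trans (tree_gf_mono W _ n (X + n) W_ge0 z0 (leq_addl _ _)) _.
  have Xn : (X <= (X + n).+1)%N by rewrite leqW ?leq_addr.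
  have tot : t + \sum_(X <= i < (X + n).+1) a i <= 1.
    apply: le_trans (tree_sum_total_le1 p p_gt0 P1 (X + n)).
    by rewrite -[leRHS](big_mkord xpredT) [leRHS](big_cat_nat (n := X)) //= big_mkord.
  rewrite /tree_gf -(big_mkord xpredT (fun i => a i * (1 - s) ^+ i)).
  rewrite (big_cat_nat (n := X)) //= big_mkord.
  apply: lerD.
    by apply: ler_sum => i _; rewrite ler_piMr // exprn_ile1.
  apply: (@le_trans _ _ ((1 - s) ^+ X * \sum_(X <= i < (X + n).+1) a i)).
    rewrite mulr_sumr big_nat_cond [leRHS]big_nat_cond; apply: ler_sum => i.
    move=> /andP[/andP[Xi _] _]; rewrite mulrC ler_wpM2r //.
    exact: ler_wiXn2l.
  by rewrite ler_wpM2l ?exprn_ge0 //; lra.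
have tFF : 1 - t <= 2 * (1 - F).
  have : (1 - s) ^+ X * (1 - t) <= 1 / 2 * (1 - t) by rewrite ler_wpM2r //; lra.
  by lra.
apply: (@le_trans _ _ ((2 * (1 - F)) ^+ 2)).
  by apply: lerXn2r; rewrite ?nnegrE //; lra.
by rewrite exprMn -/s; nra.
Qed.

(** The tail is at least of order 1 / x at x and at most half of that at B x ^ 2,
    so some size in between has weight at least of order x ^ - 3. *)
Lemma exists_frequent_size : exists B : nat, (1 < B)%N /\
  exists2 D : R, 1 <= D &
  forall x, (0 < x)%N -> exists2 L, (x <= L < B * x ^ 2)%N &
    (D * x%:R ^+ 3)^-1 <= p 2 * a L.
Proof.
have C4 := C_ge4.
(* With this B, the bound sqrt (8 / (p 2 * X)) at X = B x ^ 2 is at most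
   1 / (8 C x), half of the lower bound at x. *)
pose B := (Num.trunc (512 * C ^+ 2 / p 2)).+2.
have BC : 512 * C ^+ 2 / p 2 <= B%:R.
  apply/ltW; apply: lt_le_trans (truncnS_gt _) _.
  by rewrite ler_nat.
exists B; split => //.
have B2 : 2 <= B%:R :> R by rewrite ler_nat.
have p21 : p 2 <= 1 by exact: pmf_le1.
exists (8 * C * B%:R / p 2).
  by rewrite ler_pdivlMr // mul1r; apply: le_trans p21 _; nra.
move=> x x0; have x1 : 1 <= x%:R :> R by rewrite ler1n.
set X := (B * x ^ 2)%N.
have xX : (x < X)%N.
  rewrite /X -mulnn; case: (x) x0 => // y _; nia.
have X1 : (1 < X)%N by lia.
have XR : X%:R = B%:R * x%:R ^+ 2 :> R by rewrite /X natrM natrX.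
set e := (8 * C * x%:R)^-1.
have e0 : 0 < e by rewrite invr_gt0 !mulr_gt0 //; lra.
have tx := progeny_tail_ge x x0.
have tX : 1 - \sum_(i < X) a i <= e.
  have t1 : \sum_(i < X) a i <= 1.
    by case: (X) X1 => // y _; apply: tree_sum_total_le1.
  rewrite -(@ler_pXn2r _ 2) ?nnegrE //; [|lra|lra].
  apply: le_trans (progeny_tail_le X X1) _.
  rewrite XR ler_pdivrMr; last by rewrite mulr_gt0 ?exprn_gt0 //; lra.
  have -> : e ^+ 2 * (B%:R * x%:R ^+ 2) = B%:R / (64 * C ^+ 2).
    by rewrite /e; field; rewrite !gt_eqF //; lra.
  rewrite ler_pdivlMr; last by rewrite mulr_gt0 ?exprn_gt0 //; lra.
  by apply: le_trans BC; rewrite le_eqVlt; apply/orP; left; apply/eqP; ring.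
have e2 : (4 * C * x%:R)^-1 = 2 * e by rewrite /e; field; rewrite !gt_eqF //; lra.
rewrite e2 in tx.
(* The tail at x is at least 2 e and the tail at X at most e. *)
have mid : e <= \sum_(x <= i < X) a i.
  move: tX; rewrite -(big_mkord xpredT) (big_cat_nat (n := x)) //=; last exact: ltnW.
  by rewrite big_mkord; lra.
have XR0 : 0 < X%:R :> R by rewrite ltr0n ltnW.
have [[L xLX aL]|no] := pselect (exists2 L, (x <= L < X)%N & e / X%:R <= a L).
  exists L => //; rewrite -(ler_pM2l (p_gt0 2)) in aL; apply: le_trans aL.
  rewrite le_eqVlt; apply/orP; left; apply/eqP.
  by rewrite /e XR; field; rewrite !gt_eqF //; lra.
(* Otherwise the fewer than X terms would all be below e / X. *)
suff : \sum_(x <= i < X) a i < e by rewrite ltNge mid.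
apply: (@le_lt_trans _ _ (\sum_(x <= i < X) e / X%:R)).
  rewrite big_nat_cond [leRHS]big_nat_cond; apply: ler_sum => i /andP[xi _].
  by rewrite leNgt; apply/negP => ei; apply: no; exists i => //; exact: ltW.
rewrite big_const_nat iter_addr_0 -[X in X < _]mulr_natl mulrCA -ltr_pdivlMl //.
rewrite mulVf ?gt_eqF // ltr_pdivrMr // mul1r ltr_nat.
by rewrite ltn_subrL x0 ltnW.
Qed.

Lemma tree_sum_ge_forest m n : p m * forest_sum W m n <= a n.+1.
Proof.
rewrite (tree_sum_rec p (fun=> 1) n (maxn m n).+1) ?ltnS ?leq_maxr //.
have mM : (m < (maxn m n).+1)%N by rewrite ltnS leq_maxl.
rewrite (bigD1 (Ordinal mM)) //= lerDl sumr_ge0 // => i _.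
by rewrite mulr_ge0 //; apply: sumr_ge0 => s _; apply: prodr_ge0 => t _; exact: W_ge0.
Qed.

(** Graft two trees under a common root. *)
Lemma tree_sum_supermul n m : p 2 * (a n * a m) <= a (n + m).+1.
Proof.
apply: le_trans (tree_sum_ge_forest 2 (n + m)); rewrite ler_wpM2l //.
set P := \poly_(i < (n + m).+1) a i.
have cP i : (i <= n + m)%N -> P`_i = a i by rewrite coef_poly ltnS => ->.
rewrite -(forest_sum_coef W 2 (n + m) P cP) expr2 coefM.
have nm : (n < (n + m).+1)%N by rewrite ltnS leq_addr.
rewrite (bigD1 (Ordinal nm)) //= addKn !cP ?leq_addr ?leq_addl // lerDl.
by apply: sumr_ge0 => i _; rewrite !cP ?leq_subr ?leq_ord // mulr_ge0.
Qed.

Lemma tree_sum_unary r n : p 1 ^+ r * a n <= a (r + n).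
Proof.
elim: r => [|r IHr]; first by rewrite mul1r.
rewrite exprS -mulrA; apply: le_trans (ler_wpM2l (p_ge0 1) IHr) _.
have := tree_sum_ge_forest 1 (r + n).
set P := \poly_(i < (r + n).+1) a i.
rewrite -(forest_sum_coef W 1 (r + n) P) ?expr1 //.
  by rewrite coef_poly ltnSn.
by move=> i ir; rewrite coef_poly ltnS ir.
Qed.

Lemma tree_sum_pow L j : (p 2 * a L) ^+ j.+1 <= p 2 * a (j * L.+1 + L)%N.
Proof.
elim: j => [|j IHj]; first by rewrite expr1 mul0n add0n.
have pa0 : 0 <= p 2 * a L by rewrite mulr_ge0.
rewrite exprS; apply: le_trans (ler_wpM2l pa0 IHj) _.
rewrite -mulrA ler_wpM2l // mulrCA.
have -> : (j.+1 * L.+1 + L = (L + (j * L.+1 + L)).+1)%N by lia.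
exact: tree_sum_supermul.
Qed.

Lemma expR_le_inv_poly (D w : R) : 1 <= D -> 0 < w ->
  expR (- (D + 6 * w)) <= (D * w ^+ 6)^-1.
Proof.
move=> D1 w0; rewrite expRN lef_pV2 ?posrE ?expR_gt0 //; last first.
  by rewrite mulr_gt0 ?exprn_gt0 //; lra.
rewrite expRD expRM_natl; apply: ler_pM.
- by lra.
- exact/exprn_ge0/ltW.
- by have := expR_ge1Dx D; lra.
- apply: lerXn2r; rewrite ?nnegrE ?expR_ge0 //; first by lra.
  by have := expR_ge1Dx w; lra.
Qed.

(** With x = w ^ 2 there is a frequent size L between w ^ 2 and B w ^ 4. A tree of
    size n is built from about n / L trees of size L and a path of at most L
    nodes. The pieces cost a factor polynomial in w each, n / w ^ 2 times, and the
    path a factor exponential in w ^ 4; both are at least exp (- C n / w) when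
    w ^ 8 <= n. *)
Lemma tree_sum_lower_bound : exists C0 : R, exists w0 : nat,
  forall w n, (w0 <= w)%N -> (w ^ 8 <= n)%N ->
  expR (- (C0 * n%:R / w%:R)) <= a n.
Proof.
have [B [B1 [D D1 freq]]] := exists_frequent_size.
pose K := - ln (p 1).
have p1K : p 1 = expR (- K) by rewrite opprK lnK // posrE.
have p11 : p 1 <= 1 by exact: pmf_le1.
have K0 : 0 <= K by rewrite oppr_ge0 -ln1 ler_ln ?posrE.
have p21 : p 2 <= 1 by exact: pmf_le1.
exists (K * B%:R + 2 * (D + 6)), B => w n Bw wn.
have w1 : (0 < w)%N by lia.
have w1R : 1 <= w%:R :> R by rewrite ler1n.
have w2 : (0 < w ^ 2)%N by rewrite expn_gt0 w1.
have [L /andP[wL LB] aL] := freq _ w2.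
rewrite -expnM /= in LB.
have BwN : (B * w ^ 5 <= n)%N.
  apply: leq_trans wn; rewrite (expnD w 3 5) leq_mul2r; apply/orP; right.
  by apply: leq_trans Bw _; rewrite -{1}(expn1 w) leq_pexp2l.
have LBw5 : (L * w <= B * w ^ 5)%N by rewrite (expnSr w 4) mulnA leq_mul2r ltnW ?orbT.
have Ln : (L <= n)%N by apply: leq_trans BwN; apply: leq_trans LBw5; rewrite leq_pmulr.
(* j.+1 trees of size L joined by j binary nodes have size j * L.+1 + L; the
   r nodes left over form a path above the root. *)
pose j := ((n - L) %/ L.+1)%N; pose r := ((n - L) %% L.+1)%N.
have njr : n = (r + (j * L.+1 + L))%N by rewrite addnA (addnC r) -divn_eq subnK.
have rL : (r <= L)%N by rewrite -ltnS ltn_mod.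
have jn : (j.+1 * w ^ 2 <= 2 * n)%N.
  have : (j.+1 * w ^ 2 <= j.+1 * L)%N by rewrite leq_mul2l wL orbT.
  by rewrite njr; nia.
apply: (@le_trans _ _ (p 1 ^+ r * a (j * L.+1 + L))); last first.
  by rewrite [X in _ <= tree_sum _ X]njr; exact: tree_sum_unary.
have rK : expR (- (K * B%:R * n%:R / w%:R)) <= p 1 ^+ r.
  rewrite p1K -expRM_natl ler_expR mulrN lerN2 ler_pdivlMr; last by lra.
  rewrite [leLHS](_ : _ = K * (r%:R * w%:R)); last by ring.
  rewrite -mulrA ler_wpM2l // -!natrM ler_nat.
  apply: leq_trans (_ : L * w <= _)%N; first by rewrite leq_mul2r rL orbT.
  by nia.
have jK : expR (- (2 * (D + 6) * n%:R / w%:R)) <= a (j * L.+1 + L).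
  apply: (@le_trans _ _ (p 2 * a (j * L.+1 + L))); last by rewrite ler_piMl.
  apply: le_trans (tree_sum_pow L j).
  apply: (@le_trans _ _ (expR (- (D + 6 * w%:R)) ^+ j.+1)).
    rewrite -expRM_natl ler_expR mulrN lerN2.
    rewrite ler_pdivlMr; last by lra.
    have jnR : j.+1%:R * w%:R ^+ 2 <= 2 * n%:R :> R by rewrite -natrX -!natrM ler_nat.
    apply: (@le_trans _ _ ((D + 6) * (j.+1%:R * w%:R ^+ 2))).
      rewrite [leLHS](_ : _ = j.+1%:R * ((D + 6 * w%:R) * w%:R)); last by ring.
      rewrite [leRHS](_ : _ = j.+1%:R * ((D + 6) * w%:R ^+ 2)); last by ring.
      rewrite ler_wpM2l //; have : D * w%:R <= D * w%:R ^+ 2; last by lra.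
      by rewrite ler_wpM2l; [| lra | nra].
    by rewrite [leRHS](_ : _ = (D + 6) * (2 * n%:R)); [rewrite ler_wpM2l //; lra|ring].
  apply: lerXn2r; rewrite ?nnegrE ?expR_ge0 ?mulr_ge0 //.
  apply: le_trans aL; rewrite natrX -exprM.
  by apply: expR_le_inv_poly => //; lra.
apply: le_trans (_ : expR (- (K * B%:R * n%:R / w%:R)) *
                     expR (- (2 * (D + 6) * n%:R / w%:R)) <= _).
  rewrite -expRD ler_expR le_eqVlt; apply/orP; left; apply/eqP; ring.
by apply: ler_pM; rewrite ?expR_ge0.
Qed.

End subexponential_lower_bound.

(** * The inverse of a superlinear function *)

Section inverse_of_superlinear.
Context {R : realType}.
Variable f : R -> R.
Hypothesis f_bij : set_bij `[0, +oo[ `[0, +oo[ f.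
Hypothesis f_ratio : forall x y : R, 0 < x -> x <= y -> f x / x <= f y / y.

Local Notation g := (nonneg_inverse f).

Let f_ge0 (x : R) : 0 <= x -> 0 <= f x.
Proof.
have [f_fun _ _] := f_bij.
by move=> x0; have := f_fun x; rewrite /= !in_itv /= !andbT; apply.
Qed.

Let f_inj (x y : R) : 0 <= x -> 0 <= y -> f x = f y -> x = y.
Proof.
have [_ fI _] := f_bij => x0 y0; apply: fI; apply/mem_set;
  by rewrite /= in_itv /= ?x0 ?y0.
Qed.

Let f_surj (y : R) : 0 <= y -> exists2 x, 0 <= x & f x = y.
Proof.
have [_ _ fS] := f_bij => y0; have [|x] := fS y; first by rewrite /= in_itv /= y0.
by rewrite /= in_itv /= andbT => x0 fxy; exists x.
Qed.

(** If f vanished at x > 0 it would vanish on ]0, x] as well, against injectivity. *)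
Lemma superlinear_gt0 x : 0 < x -> 0 < f x.
Proof.
move=> x0; rewrite lt_neqAle f_ge0 ?ltW // andbT eq_sym; apply/eqP => fx0.
have h0 : 0 < x / 2 by lra.
have := f_ratio (x / 2) x h0 ltac:(lra); rewrite fx0 mul0r => fh.
have fh0 : f (x / 2) = 0.
  apply/eqP; rewrite eq_le (f_ge0 _ (ltW h0)) andbT.
  by have := ler_wpM2r (ltW h0) fh; rewrite mul0r divfK ?gt_eqF.
have : x / 2 = x by apply: f_inj; rewrite ?fh0 //; lra.
by lra.
Qed.

Lemma superlinear0 : f 0 = 0.
Proof.
have [x x0 fx] := f_surj 0 (lexx _).
move: x0 fx; rewrite le_eqVlt => /predU1P[<- //|xp fx].
by have := superlinear_gt0 x xp; rewrite fx ltxx.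
Qed.

Lemma superlinear_contract c x : 0 <= c <= 1 -> 0 <= x -> f (c * x) <= c * f x.
Proof.
move=> /andP[c0 c1] x0.
have [->|cn0] := eqVneq c 0; first by rewrite !mul0r superlinear0.
have [->|xn0] := eqVneq x 0; first by rewrite !(mulr0, superlinear0).
have cp : 0 < c by rewrite lt_neqAle eq_sym cn0.
have xp : 0 < x by rewrite lt_neqAle eq_sym xn0.
have cx : 0 < c * x by rewrite mulr_gt0.
have := f_ratio (c * x) x cx ltac:(nra).
rewrite ler_pdivrMr // => /le_trans; apply.
by rewrite le_eqVlt; apply/orP; left; apply/eqP; field.
Qed.

Lemma superlinear_lt x y : 0 <= x -> x < y -> f x < f y.
Proof.
move=> x0 xy; have y0 : 0 < y by lra.
have fy := superlinear_gt0 y y0.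
have xy1 : 0 <= x / y < 1.
  by apply/andP; split; [exact/divr_ge0/ltW | rewrite ltr_pdivrMr // mul1r].
have := superlinear_contract (x / y) y; rewrite divfK ?gt_eqF //.
by move=> /(_ ltac:(lra) (ltW y0)) fxy; nra.
Qed.

Lemma superlinear_le x y : 0 <= x -> x <= y -> f x <= f y.
Proof.
by move=> x0; rewrite le_eqVlt => /predU1P[->//|xy]; apply/ltW/superlinear_lt.
Qed.

(** x and y are the fractions x / (x + y) and y / (x + y) of x + y, and f shrinks
    at least as fast as its argument. *)
Lemma superlinear_superadd x y : 0 <= x -> 0 <= y -> f x + f y <= f (x + y).
Proof.
move=> x0 y0; have [xy0|xy] := eqVneq (x + y) 0.
  have [-> ->] : x = 0 /\ y = 0 by split; lra.
  by rewrite addr0 superlinear0 addr0.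
have xyp : 0 < x + y by rewrite lt_neqAle eq_sym xy addr_ge0.
have part z : 0 <= z <= x + y -> f z <= z / (x + y) * f (x + y).
  move=> /andP[z0 zxy]; rewrite -{1}(divfK xy z); apply: superlinear_contract.
    by apply/andP; split; [exact/divr_ge0/ltW | rewrite ler_pdivrMr // mul1r].
  exact: ltW.
have fx := part x ltac:(lra); have fy := part y ltac:(lra).
apply: le_trans (lerD fx fy) _; rewrite -mulrDl -mulrDl divff // mul1r.
exact: lexx.
Qed.

Lemma nonneg_inverse_ge0 y : 0 <= g y.
Proof.
rewrite /nonneg_inverse /pinv_ splitV oinv_surj; case: pselect => //= img.
by case: cid2 => z /=; rewrite in_itv /= andbT.
Qed.

Lemma nonneg_inverse_lt0 y : y < 0 -> g y = 0.
Proof.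
move=> y0; rewrite /nonneg_inverse /pinv_ splitV oinv_surj.
case: pselect => //= img; exfalso; move: img => [x].
rewrite /= in_itv /= andbT => x0 fx.
by have := f_ge0 x x0; rewrite fx leNgt y0.
Qed.

Lemma nonneg_inverseK y : 0 <= y -> f (g y) = y.
Proof.
move=> y0; rewrite /nonneg_inverse pinvK //; apply/mem_set.
by have [x x0 fx] := f_surj y y0; exists x; rewrite //= in_itv /= x0.
Qed.

Lemma le_nonneg_inverse x y : 0 <= x -> 0 <= y -> (x <= g y) = (f x <= y).
Proof.
move=> x0 y0; apply/idP/idP => [xg|fx].
  by rewrite -(nonneg_inverseK y y0); apply: superlinear_le.
rewrite leNgt; apply/negP => gx.
have := superlinear_lt _ _ (nonneg_inverse_ge0 y) gx.
by rewrite nonneg_inverseK // ltNge fx.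
Qed.

Lemma nonneg_inverse_le x y : 0 <= x -> 0 <= y -> (g y <= x) = (y <= f x).
Proof.
move=> x0 y0; apply/idP/idP => [gx|yf].
  rewrite -{1}(nonneg_inverseK y y0); apply: superlinear_le => //.
  exact: nonneg_inverse_ge0.
rewrite leNgt; apply/negP => xg.
by have := superlinear_lt _ _ x0 xg; rewrite nonneg_inverseK // ltNge yf.
Qed.

Lemma nonneg_inverse_homo y y' : y <= y' -> g y <= g y'.
Proof.
move=> yy'; have [y0|y0] := ltP y 0.
  by rewrite (nonneg_inverse_lt0 y y0) nonneg_inverse_ge0.
have y'0 : 0 <= y' by lra.
by rewrite le_nonneg_inverse ?nonneg_inverse_ge0 // nonneg_inverseK.
Qed.

Hypothesis f_slope : f x / x @[x --> +oo] --> +oo.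

Lemma superlinear_ge_affine A : exists2 B, 0 <= B & forall x, 0 <= x -> A * x - B <= f x.
Proof.
have [x0 [_ big]] := (cvgryPge (fun x => f x / x)).1 f_slope A.
pose y := Num.max x0 0; exists (`|A| * y) => [|x xge0].
  by rewrite mulr_ge0 ?normr_ge0 // le_max lexx orbT.
have [xy|yx] := leP x y.
  apply: le_trans (f_ge0 x xge0); rewrite subr_le0.
  by apply: le_trans (ler_wpM2r xge0 (ler_norm A)) _; apply: ler_wpM2l.
have yge0 : 0 <= y by rewrite le_max lexx orbT.
have xx0 : x0 < x by apply: le_lt_trans yx; rewrite le_max lexx.
have /= := big x xx0; rewrite ler_pdivlMr; last exact: le_lt_trans yx.
by apply: le_trans; rewrite gerBl mulr_ge0.
Qed.

End inverse_of_superlinear.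

(** * Weights of small trees, paths and stars *)

Lemma expR_beats_affine {R : realType} (c M : R) : 0 < c ->
  exists L0 : R, forall L, L0 <= L -> M * L + M <= expR (c * L).
Proof.
move=> c0; exists (1 + 8 * `|M| / c ^+ 2) => L hL.
have q0 : 0 <= 8 * `|M| / c ^+ 2 by rewrite divr_ge0 ?sqr_ge0 // mulr_ge0.
have L1 : 1 <= L by lra.
have cL : 8 * `|M| <= c ^+ 2 * L.
  by rewrite [leRHS]mulrC -ler_pdivrMr ?exprn_gt0 //; lra.
have half : 1 + c * L / 2 <= expR (c * L / 2) by exact: expR_ge1Dx.
have cL0 : 0 <= c * L by nra.
have sq : (1 + c * L / 2) ^+ 2 <= expR (c * L).
  rewrite [X in expR X](_ : _ = c * L / 2 + c * L / 2); last by lra.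
  rewrite expRD -expr2; apply: lerXn2r; rewrite ?nnegrE ?expR_ge0 //; lra.
have ML : M * L + M <= `|M| * (2 * L).
  have := ler_norm M; have := normr_ge0 M; nra.
apply: le_trans ML _; apply: le_trans sq.
have : 8 * `|M| * L <= c ^+ 2 * L * L by rewrite ler_wpM2r //; lra.
have := normr_ge0 M; nra.
Qed.

(** 1 - x / 2 <= exp (- x / 2), and (1 + x) (1 - x / 2) >= 1 on [0, 1]. *)
Lemma expR_half_le {R : realType} (x : R) : 0 <= x <= 1 -> expR (x / 2) <= 1 + x.
Proof.
move=> /andP[x0 x1]; have e1 : 1 - x / 2 <= expR (- (x / 2)).
  by have := expR_ge1Dx (- (x / 2)); lra.
have := expR_gt0 (x / 2) => e0.
have e2 : expR (x / 2) * expR (- (x / 2)) = 1 by rewrite -expRD subrr expR0.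
have : expR (x / 2) * (1 - x / 2) <= 1 by rewrite -[leRHS]e2 ler_wpM2l // ltW.
by nra.
Qed.

Lemma pow_damped_le {R : realType} (x : R) n y : 0 <= x <= 1 ->
  y%:R <= n%:R * x / 4 -> 2 ^+ y * (1 + x) ^- n <= expR (- (n%:R * x / 4)).
Proof.
move=> /andP[x0 x1] yx.
have e2 : 2 <= expR 1 :> R by have := expR_ge1Dx (1 : R); lra.
have two : 2 ^+ y <= expR (n%:R * x / 4).
  apply: (@le_trans _ _ (expR 1 ^+ y)).
    by apply: lerXn2r; rewrite ?nnegrE ?expR_ge0.
  by rewrite -expRM_natl mulr1 ler_expR.
have onex : (1 + x) ^- n <= expR (- (n%:R * x / 2)).
  rewrite expRN lef_pV2 ?posrE ?expR_gt0 ?exprn_gt0 //; last by lra.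
  rewrite -mulrA expRM_natl; apply: lerXn2r; rewrite ?nnegrE ?expR_ge0 //.
    by lra.
  by apply: expR_half_le; rewrite x0.
apply: le_trans (ler_pM _ _ two onex) _.
- exact: exprn_ge0.
- by rewrite invr_ge0 exprn_ge0 //; lra.
- by rewrite -expRD ler_expR; lra.
Qed.

Lemma pow_retry_le {R : realType} (q : R) y : 0 <= q <= 1 ->
  (1 + q) ^- y <= expR (- (y%:R * (q / 2))).
Proof.
move=> /andP[q0 q1].
rewrite expRN lef_pV2 ?posrE ?expR_gt0 ?exprn_gt0 //; last by lra.
rewrite expRM_natl; apply: lerXn2r; rewrite ?nnegrE ?expR_ge0 //; first by lra.
by apply: expR_half_le; rewrite q0.
Qed.

Lemma near_ln_ge {R : realType} (L0 : R) : \forall n \near \oo, L0 <= ln n%:R.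
Proof.
exists (Num.trunc (expR L0)).+1 => // n /= hn.
rewrite -[leLHS]expRK ler_ln ?posrE ?expR_gt0 ?ltr0n //; last exact: leq_trans hn.
by apply/ltW; apply: lt_le_trans (truncnS_gt _) _; rewrite ler_nat.
Qed.

Section weight_estimates.
Context {R : realType}.
Variables (p : nat -> R) (f : R -> R).
Hypothesis p_gt0 : forall i, 0 < p i.
Hypothesis sum_p_le1 : forall n, \sum_(i < n) p i <= 1.
Hypothesis p_tail : super_exponential_tail f p.
Hypothesis f_bij : set_bij `[0, +oo[ `[0, +oo[ f.

Local Notation W := (gw_weight p).
Local Notation a := (tree_sum W).
Let W_ge0 := gw_weight_ge0 p p_gt0.

Let f_ratio : forall x y : R, 0 < x -> x <= y -> f x / x <= f y / y.
Proof. by case: p_tail => _ _ _ _ []. Qed.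
Let f_slope : f x / x @[x --> +oo] --> +oo.
Proof. by case: p_tail => _ _ _ _ []. Qed.
Let f_ge0 x : 0 <= x -> 0 <= f x.
Proof. by case: p_tail => _ _ _ + _; apply. Qed.

Lemma tail_equiv e : 0 < e ->
  exists m0 : nat, forall m, (m0 <= m)%N ->
    `|- ln (p m) - f m%:R| <= e * f m%:R.
Proof.
move=> e0; case: p_tail => _ _ /eqaddoP/(_ e e0) [m0 _ near_m0] _ _.
exists m0 => m m0m; have := near_m0 m m0m.
by rewrite /= !fctE lnV ?posrE // (ger0_norm (f_ge0 _ (ler0n _ m))).
Qed.

Lemma neg_ln_p_ge0 i : 0 <= - ln (p i).
Proof. by rewrite oppr_ge0 -ln1 ler_ln ?posrE // (pmf_le1 p p_gt0 sum_p_le1). Qed.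

Lemma neg_ln_p_le e : 0 < e ->
  exists2 C : R, 0 <= C & forall i : nat, - ln (p i) <= (1 + e) * f i%:R + C.
Proof.
move=> e0; have [m0 tail] := tail_equiv e e0.
exists (\sum_(i < m0) - ln (p i)) => [|i].
  by apply: sumr_ge0 => i _; exact: neg_ln_p_ge0.
have fi : 0 <= f i%:R by exact: f_ge0.
have [m0i|im0] := leqP m0 i.
  have := tail i m0i; rewrite ler_norml => /andP[_ up].
  have : 0 <= \sum_(i < m0) - ln (p i).
    by apply: sumr_ge0 => j _; exact: neg_ln_p_ge0.
  lra.
rewrite (bigD1 (Ordinal im0)) //=.
have : 0 <= \sum_(j < m0 | j != Ordinal im0) - ln (p j).
  by apply: sumr_ge0 => j _; exact: neg_ln_p_ge0.
have : 0 <= (1 + e) * f i%:R by rewrite mulr_ge0 //; lra.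
lra.
Qed.

(** The numbers of children in t add up to the size of t minus 1, so
    superadditivity bounds the sum of the values of f by f of that number. *)
Lemma gw_weight_ge e : 0 < e -> exists2 C : R, 0 <= C & forall t,
  expR (- ((1 + e) * f (tree_size t).-1%:R + C * (tree_size t)%:R)) <= W t.
Proof.
move=> e0; have [C C0 hC] := neg_ln_p_le e e0; exists C => //.
elim/plane_tree_mem_ind => s IHs; rewrite gw_weightE /=.
have f00 : f 0 = 0 by exact: superlinear0.
have forest l : {subset l <= s} ->
    expR (- ((1 + e) * f (forest_size l - size l)%:R + C * (forest_size l)%:R))
    <= \prod_(t <- l) W t.
  elim: l => [|t l IHl] ls.
    by rewrite big_nil /forest_size /= f00 !mulr0 addr0 oppr0 expR0.
  rewrite big_cons.
  have IHt := IHs t (ls t (mem_head _ _)).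
  have {}IHl := IHl (fun u ul => ls u (mem_behead (ul : u \in behead (t :: l)))).
  apply: le_trans (ler_pM (expR_ge0 _) (expR_ge0 _) IHt IHl).
  rewrite -expRD ler_expR -opprD lerN2.
  have szl := size_le_forest_size l; have sz := tree_size_gt0 t.
  have -> : (forest_size (t :: l) - size (t :: l) =
      (tree_size t).-1 + (forest_size l - size l))%N.
    by rewrite /forest_size /= -/(forest_size l); lia.
  have -> : forest_size (t :: l) = (tree_size t + forest_size l)%N by [].
  have := superlinear_superadd f f_bij f_ratio (tree_size t).-1%:R
    (forest_size l - size l)%:R (ler0n _ _) (ler0n _ _).
  rewrite -natrD => sup.
  have : (1 + e) * (f (tree_size t).-1%:R + f (forest_size l - size l)%:R) <=
         (1 + e) * f ((tree_size t).-1 + (forest_size l - size l))%:R.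
    by rewrite ler_wpM2l //; lra.
  by rewrite [(_ + forest_size l)%:R]natrD; lra.
have root : expR (- ((1 + e) * f (size s)%:R + C)) <= p (size s).
  by rewrite -[leRHS]lnK ?posrE // ler_expR lerNl; exact: hC.
apply: le_trans (ler_pM (expR_ge0 _) (expR_ge0 _) root (forest s (fun _ => id))).
rewrite -expRD ler_expR -opprD lerN2 -/(forest_size s).
have szs := size_le_forest_size s.
have := superlinear_superadd f f_bij f_ratio (size s)%:R
    (forest_size s - size s)%:R (ler0n _ _) (ler0n _ _).
rewrite -natrD subnKC // => sup.
have : (1 + e) * (f (size s)%:R + f (forest_size s - size s)%:R) <=
       (1 + e) * f (forest_size s)%:R.
  by rewrite ler_wpM2l //; lra.
by rewrite -[(forest_size s).+1%:R]natr1; lra.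
Qed.

(** f exceeds every linear function, so trees within reach have size o(log n).
    Here and below L stands for log n. *)
Lemma size_negligible e : 0 < e -> exists L0 : R, forall L (k : nat),
  L0 <= L -> f k.-1%:R <= L -> k%:R <= e * L.
Proof.
move=> e0; have [B B0 aff] := superlinear_ge_affine f f_bij f_slope (2 / e).
exists (2 / e * (1 + B * e / 2)) => L k hL fk.
have := aff k.-1%:R (ler0n _ _); rewrite -subr_ge0 => h.
have : k.-1%:R <= (L + B) * (e / 2).
  rewrite -(@ler_pM2l _ (2 / e)) ?divr_gt0 //.
  rewrite (_ : 2 / e * ((L + B) * (e / 2)) = L + B); last by field; lra.
  by lra.
have : k%:R <= k.-1%:R + 1 :> R by rewrite natr1 ler_nat; lia.
have : 1 + B * e / 2 <= L * (e / 2).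
  rewrite -(@ler_pM2l _ (2 / e)) ?divr_gt0 //.
  by rewrite (_ : 2 / e * (L * (e / 2)) = L); last by field; lra.
lra.
Qed.

Lemma gw_weight_ge_log delta : 0 < delta < 1 -> exists L0 : R, forall L t,
  L0 <= L -> f (tree_size t).-1%:R <= (1 - delta) * L ->
  expR (- ((1 - delta / 2) * L)) <= W t.
Proof.
move=> /andP[d0 d1]; have [C C0 hC] := gw_weight_ge (delta / 4) ltac:(lra).
have e0 : 0 < delta / (4 * (C + 1)) by rewrite divr_gt0 //; lra.
have [L0 neg] := size_negligible _ e0.
exists (Num.max L0 0) => L t; rewrite ge_max => /andP[L0L Lge0] ft.
apply: le_trans (hC t); rewrite ler_expR lerN2.
have fL : f (tree_size t).-1%:R <= L by nra.
have := neg L (tree_size t) L0L fL; set K := (tree_size t)%:R => KL.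
have : C * K <= delta / 4 * L.
  apply: (@le_trans _ _ ((C + 1) * (delta / (4 * (C + 1)) * L))).
    have K0 : 0 <= K by []; nra.
  by rewrite le_eqVlt; apply/orP; left; apply/eqP; field; lra.
have : (1 + delta / 4) * f (tree_size t).-1%:R <= (1 + delta / 4) * ((1 - delta) * L).
  by rewrite ler_wpM2l //; lra.
have : 0 <= delta ^+ 2 * L by rewrite mulr_ge0 ?sqr_ge0.
nra.
Qed.

Lemma gw_weight_path k : W (path_tree k) = p 1 ^+ k.-1 * p 0.
Proof.
rewrite /path_tree; elim: k.-1 => [|j IHj].
  by rewrite gw_weightE big_nil mulr1 expr0 mul1r.
by rewrite /= gw_weightE big_seq1 IHj exprS mulrA.
Qed.

Lemma gw_weight_star m : W (star_tree m) = p m * p 0 ^+ m.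
Proof.
rewrite gw_weightE size_nseq; congr (_ * _); elim: m => [|m IHm].
  by rewrite big_nil.
by rewrite big_cons IHm exprS gw_weightE big_nil mulr1.
Qed.

Let K : R := 1 - ln (p 0) - ln (p 1).
Let K_ge1 : 1 <= K.
Proof. by have := neg_ln_p_ge0 0; have := neg_ln_p_ge0 1; rewrite /K; lra. Qed.

(** 1 / k is absorbed by the bound k <= exp k; this is the summand 1 in K. *)
Lemma path_weight_ge_exp k : (0 < k)%N -> expR (- (K * k%:R)) <= W (path_tree k) / k%:R.
Proof.
move=> k0; have k1 : 1 <= k%:R :> R by rewrite ler1n.
rewrite gw_weight_path ler_pdivlMr; last by lra.
have kk : k%:R <= expR k%:R :> R by have := expR_ge1Dx (k%:R : R); lra.
apply: le_trans (ler_wpM2l (expR_ge0 _) kk) _; rewrite -expRD.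
have -> : p 1 ^+ k.-1 * p 0 = expR (k.-1%:R * ln (p 1) + ln (p 0)).
  by rewrite expRD expRM_natl !lnK ?posrE.
rewrite ler_expR.
have k1k : k.-1%:R <= k%:R :> R by rewrite ler_nat leq_pred.
have := neg_ln_p_ge0 0; have := neg_ln_p_ge0 1; rewrite /K; nra.
Qed.

Lemma path_weight_ge_log e : 0 < e -> exists L0 : R, forall L k, (0 < k)%N ->
  L0 <= L -> f k.-1%:R <= L -> expR (- (e * L)) <= W (path_tree k) / k%:R.
Proof.
move=> e0; have K1 := K_ge1.
have eK : 0 < e / K by rewrite divr_gt0 //; lra.
have [L0 neg] := size_negligible _ eK; exists L0 => L k k0 L0L fk.
apply: le_trans (path_weight_ge_exp k k0); rewrite ler_expR lerN2.
rewrite mulrC -ler_pdivlMr; last by lra.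
by apply: le_trans (neg L k L0L fk) _; rewrite mulrAC.
Qed.

(** Up to factors exponential in m, which f absorbs, the ratio is the
    probability of having m children. *)
Lemma star_path_ratio_le delta : 0 < delta <= 1 -> exists L0 : R, forall L (m : nat),
  L0 <= L -> (1 + delta) * L <= f m%:R ->
  W (star_tree m) / W (path_tree m.+1) <= expR (- ((1 + delta / 2) * L)).
Proof.
move=> /andP[d0 d1]; have K1 := K_ge1.
have [m0 tail] := tail_equiv (delta / 8) ltac:(lra).
have [B B0 aff] := superlinear_ge_affine f f_bij f_slope (16 * K / delta).
exists (Num.max 0 (Num.max ((16 * B + 16 * K) / delta) (f m0%:R))) => L m.
rewrite !ge_max; move=> /and3P[L0 LB Lm0] fm.
have fmL : L <= f m%:R by nra.
have m0m : (m0 <= m)%N.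
  rewrite leqNgt; apply/negP => mm0.
  have := superlinear_lt f f_bij f_ratio m%:R m0%:R (ler0n _ _).
  by rewrite ltr_nat => /(_ mm0); lra.
have := tail m m0m; rewrite ler_norml => /andP[lo _].
have Km : K * m.+1%:R <= delta / 8 * f m%:R.
  have := aff m%:R (ler0n _ _).
  rewrite -(@ler_pM2l _ (delta / 16)); last by lra.
  rewrite mulrBr (_ : delta / 16 * (16 * K / delta * m%:R) = K * m%:R); last by field; lra.
  have : 16 * B + 16 * K <= delta * L by rewrite [leRHS]mulrC -ler_pdivrMr.
  have : delta * L <= delta * f m%:R by rewrite ler_wpM2l //; lra.
  have : delta * B <= B by rewrite ler_piMl.
  by rewrite -[m.+1%:R]natr1; lra.
rewrite gw_weight_star.
have := path_weight_ge_exp m.+1 isT; rewrite ler_pdivlMr ?ltr0n // => path.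
have pathm : expR (- (K * m.+1%:R)) <= W (path_tree m.+1).
  by apply: le_trans path; rewrite ler_peMr ?expR_ge0 // ler1n.
have pm : p m * p 0 ^+ m <= expR (- ((1 - delta / 8) * f m%:R)).
  apply: (@le_trans _ _ (p m)).
    have p_ge0 i : 0 <= p i := ltW (p_gt0 i).
    by rewrite ler_piMr // exprn_ile1 // (pmf_le1 p p_gt0 sum_p_le1).
  by rewrite -[leLHS]lnK ?posrE // ler_expR; lra.
rewrite ler_pdivrMr ?gw_weight_gt0 //.
apply: le_trans pm _; apply: le_trans (ler_wpM2l (expR_ge0 _) pathm).
rewrite -expRD ler_expR.
have : (1 + delta / 2) * L <= (1 - delta / 4) * ((1 + delta) * L).
  have : 0 <= (delta * (1 - delta)) * L by rewrite !mulr_ge0 //; lra.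
  by nra.
have : (1 - delta / 4) * ((1 + delta) * L) <= (1 - delta / 4) * f m%:R.
  by rewrite ler_wpM2l //; lra.
by lra.
Qed.

(** The weight of the trees with few paths is at most exp (- n x / 4), where n x
    is at least of order n ^ (15 / 16); this beats the lower bound
    exp (- C0 n / w) for a n with w of order n ^ (1 / 8). *)
Lemma damped_negligible e : 0 < e ->
  (exists C0 : R, exists w0 : nat, forall w n, (w0 <= w)%N -> (w ^ 8 <= n)%N ->
     expR (- (C0 * n%:R / w%:R)) <= a n) ->
  \forall n \near \oo, forall x : R, expR (- (1 / 16 * ln n%:R)) / 2 <= x ->
    expR (- (n%:R * x / 4)) <= e * a n.
Proof.
move=> e0 [C0 [w0 a_lower]].
have eE : expR (- `|ln e|) <= e.
  rewrite -[leRHS]lnK ?posrE // ler_expR lerNl.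
  by have := ler_norm (- ln e); rewrite normrN.
near=> n => x.
have n1 : (0 < n)%N by near: n; exact: nbhs_infty_gt.
have nL : n%:R = expR (ln n%:R) :> R by rewrite lnK // posrE ltr0n.
have big1 : 16 * (8 * (2 * `|C0| + `|ln e|)) <= ln n%:R by near: n; exact: near_ln_ge.
have big2 : 8 * (w0.+1%:R + 1) <= ln n%:R :> R by near: n; exact: near_ln_ge.
move: (ln n%:R) nL big1 big2 => L nL big1 big2 xlow.
have w01 : 1 <= w0.+1%:R :> R by rewrite ler1n.
have L0 : 0 <= L by lra.
pose w := Num.trunc (expR (L / 8)).
have [wlow wup] : w%:R <= expR (L / 8) /\ expR (L / 8) <= w%:R + 1.
  by split; [rewrite truncn_le // expR_ge0 | rewrite natr1; exact/ltW/truncnS_gt].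
have eL8 : w0.+1%:R + 1 <= expR (L / 8) by have := expR_ge1Dx (L / 8); lra.
have w0w : (w0.+1 <= w)%N by rewrite -(ler_nat R); lra.
have w1 : 1 <= w%:R :> R by rewrite ler1n; exact: leq_trans w0w.
have w8 : (w ^ 8 <= n)%N.
  rewrite -(ler_nat R) natrX nL.
  have -> : expR L = expR (L / 8) ^+ 8 by rewrite -expRM_natl; congr expR; field.
  by apply: lerXn2r; rewrite ?nnegrE ?expR_ge0.
apply: le_trans (ler_pM (expR_ge0 _) (expR_ge0 _) eE (a_lower w n (ltnW w0w) w8)).
rewrite -expRD ler_expR.
set u := expR (7 / 8 * L).
have E1 : n%:R / w%:R <= 2 * u.
  rewrite ler_pdivrMr; last by lra.
  have -> : n%:R = u * expR (L / 8) by rewrite nL -expRD; congr expR; field.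
  have u0 : 0 < u by exact: expR_gt0.
  rewrite [leRHS](_ : _ = u * (2 * w%:R)); last by ring.
  by rewrite ler_pM2l //; lra.
have E2 : C0 * n%:R / w%:R <= `|C0| * (2 * u).
  rewrite -mulrA; apply: (@le_trans _ _ (`|C0| * (n%:R / w%:R))).
    by rewrite ler_wpM2r ?divr_ge0 // ler_norm.
  by rewrite ler_wpM2l.
have E3 : u * expR (L / 16) / 2 <= n%:R * x.
  have -> : u * expR (L / 16) = n%:R * expR (- (1 / 16 * L)).
    by rewrite nL -!expRD; congr expR; field.
  by rewrite -mulrA ler_wpM2l.
have E4 : 8 * (2 * `|C0| + `|ln e|) <= expR (L / 16).
  by have := expR_ge1Dx (L / 16); lra.
have E5 : 1 <= u by rewrite -expR0 ler_expR mulr_ge0.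
have E6 : u * (8 * (2 * `|C0| + `|ln e|)) <= u * expR (L / 16).
  by rewrite ler_wpM2l // expR_ge0.
have E7 : `|ln e| <= u * `|ln e| by rewrite ler_peMl // normr_ge0.
by lra.
Unshelve. all: by end_near. Qed.

(** The number Y of chances is at least of order n ^ (1 - delta / 4), while each
    succeeds with probability q = n ^ (- 1 + delta / 2), so the failure probability
    is at most exp (- n ^ (delta / 4) / 16), up to a constant. The factor q ^ - 1
    bounds the number of trees in the union bound. *)
Lemma retry_negligible delta e : 0 < delta < 1 -> 0 < e ->
  \forall n \near \oo, forall q x Y : R,
    q = expR (- ((1 - delta / 2) * ln n%:R)) ->
    expR (- (delta / 4 * ln n%:R)) / 2 <= x -> n%:R * x / 4 <= Y + 1 ->
    q^-1 * expR (- (Y * (q / 2))) <= e.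
Proof.
move=> /andP[d0 d1] e0.
have eE : expR (- `|ln e|) <= e.
  rewrite -[leRHS]lnK ?posrE // ler_expR lerNl.
  by have := ler_norm (- ln e); rewrite normrN.
have d4 : 0 < delta / 4 by lra.
have [L3 beats] := expR_beats_affine (delta / 4) (16 * (1 + `|ln e|)) d4.
near=> n => q x Y.
have n1 : (0 < n)%N by near: n; exact: nbhs_infty_gt.
have nL : n%:R = expR (ln n%:R) :> R by rewrite lnK // posrE ltr0n.
have {}beats : 16 * (1 + `|ln e|) * ln n%:R + 16 * (1 + `|ln e|) <=
    expR (delta / 4 * ln n%:R) by apply: beats; near: n; exact: near_ln_ge.
have L0 : 0 <= ln n%:R :> R by near: n; exact: near_ln_ge.
move: (ln n%:R) nL beats L0 => L nL beats L0 qE xlow Ylow.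
have q0 : 0 < q by rewrite qE expR_gt0.
have q1 : q <= 1 by rewrite qE -[leRHS]expR0 ler_expR oppr_le0 mulr_ge0 //; lra.
have qinv : q^-1 <= expR L.
  rewrite qE expRN invrK ler_expR ler_piMl //; lra.
have nqx : expR (delta / 4 * L) / 2 <= n%:R * x * q.
  apply: (@le_trans _ _ (n%:R * (expR (- (delta / 4 * L)) / 2) * q)); last first.
    by rewrite ler_wpM2r ?ler_wpM2l // ltW.
  rewrite [leRHS](_ : _ = n%:R * expR (- (delta / 4 * L)) * q / 2); last by ring.
  by rewrite ler_wpM2r // nL qE -!expRD ler_expR; lra.
have qY : (n%:R * x / 4) * (q / 2) <= (Y + 1) * (q / 2) by rewrite ler_wpM2r //; lra.
apply: le_trans (ler_wpM2r (expR_ge0 _) qinv) _.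
apply: le_trans eE; rewrite -expRD ler_expR.
have : 0 <= 16 * `|ln e| * L by rewrite !mulr_ge0 ?normr_ge0.
by lra.
Unshelve. all: by end_near. Qed.

Lemma sum_missing_negligible delta e : 0 < delta < 1 -> 0 < e ->
  (exists C0 : R, exists w0 : nat, forall w n, (w0 <= w)%N -> (w ^ 8 <= n)%N ->
     expR (- (C0 * n%:R / w%:R)) <= a n) ->
  \forall n \near \oo, forall k, (0 < k)%N ->
    f k.-1%:R <= (1 - delta) * ln n%:R ->
    \sum_(t <- trees n | has (fun T => T \notin fringe_subtrees t) (trees k)) W t
    <= e * a n.
Proof.
move=> d01 e0 a_lower; have /andP[d0 d1] := d01.
have e2 : 0 < e / 2 by lra.
(* eta <= delta / 4 serves the union bound, eta <= 1 / 16 the comparison with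
   the lower bound on a n. *)
pose eta := Num.min (delta / 4) (1 / 16).
have eta_gt0 : 0 < eta by rewrite lt_min; lra.
have [eta1 eta2] : eta <= delta / 4 /\ eta <= 1 / 16.
  by rewrite !ge_min !lexx orbT.
have [L1 weights] := gw_weight_ge_log delta d01.
have [L2 paths] := path_weight_ge_log eta eta_gt0.
near=> n => k k0 fk.
have n1 : (0 < n)%N by near: n; exact: nbhs_infty_gt.
have L0 : 0 <= ln n%:R :> R by near: n; exact: near_ln_ge.
have k1 : 1 <= k%:R :> R by rewrite ler1n.
set q := expR (- ((1 - delta / 2) * ln n%:R)).
have q0 : 0 < q by exact: expR_gt0.
have q1 : q <= 1 by rewrite -expR0 ler_expR oppr_le0 mulr_ge0 //; lra.
have qW T : tree_size T = k -> q <= W T.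
  move=> Tk; apply: weights; rewrite ?Tk //; near: n; exact: near_ln_ge.
set x := W (path_tree k) / (2 * k%:R).
have xlow : expR (- (eta * ln n%:R)) / 2 <= x.
  rewrite /x [2 * _]mulrC invfM mulrA ler_wpM2r //; apply: paths => //.
    by near: n; exact: near_ln_ge.
  by apply: le_trans fk _; rewrite ler_piMl //; lra.
have xlow_of c : eta <= c -> expR (- (c * ln n%:R)) / 2 <= x.
  move=> ec; apply: le_trans xlow; rewrite ler_wpM2r // ler_expR lerN2.
  by rewrite ler_wpM2r.
have x0 : 0 <= x by rewrite divr_ge0 ?W_ge0 // mulr_ge0.
have x1 : x <= 1.
  rewrite ler_pdivrMr; last by lra.
  by have := gw_weight_le1 p p_gt0 sum_p_le1 (path_tree k); lra.
pose y := Num.trunc (n%:R * x / 4).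
have nx0 : 0 <= n%:R * x / 4 by rewrite divr_ge0 // mulr_ge0.
apply: le_trans (sum_missing_le p p_gt0 sum_p_le1 k n y q k0 (ltW q0) qW) _.
rewrite -/x (_ : e * a n = e / 2 * a n + e / 2 * a n); last by field.
apply: lerD.
  apply: le_trans (pow_damped_le x n y _ _) _; first by rewrite x0.
    by rewrite truncn_le.
  have damped : forall x : R, expR (- (1 / 16 * ln n%:R)) / 2 <= x ->
    expR (- (n%:R * x / 4)) <= e / 2 * a n by near: n; exact: damped_negligible.
  exact/damped/xlow_of.
apply: ler_wpM2r; first exact: tree_sum_ge0.
have count : (size (trees k))%:R <= q^-1.
  rewrite -[leRHS]mul1r ler_pdivlMr //.
  apply: le_trans (tree_sum_le1 p p_gt0 sum_p_le1 k).
  rewrite mulr_natl -iter_addr_0 -(count_predT (trees k)) -big_const_seq.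
  rewrite /tree_sum big_seq [leRHS]big_seq; apply: ler_sum => T.
  by rewrite mem_trees => /eqP; exact: qW.
apply: le_trans (ler_pM _ _ count (pow_retry_le q y _)) _ => //.
- by rewrite invr_ge0 exprn_ge0 // addr_ge0 // ltW.
- by rewrite ltW.
have retry : forall q x Y : R,
    q = expR (- ((1 - delta / 2) * ln n%:R)) ->
    expR (- (delta / 4 * ln n%:R)) / 2 <= x -> n%:R * x / 4 <= Y + 1 ->
    q^-1 * expR (- (Y * (q / 2))) <= e / 2 by near: n; exact: retry_negligible.
apply: (retry q x) => //; first exact: xlow_of.
by rewrite natr1; exact/ltW/truncnS_gt.
Unshelve. all: by end_near. Qed.

Lemma sum_star_negligible delta e : 0 < delta <= 1 -> 0 < e ->
  \forall n \near \oo, forall m : nat, (1 + delta) * ln n%:R <= f m%:R ->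
    \sum_(t <- trees n | star_tree m \in fringe_subtrees t) W t <= e * a n.
Proof.
move=> d01 e0; have /andP[d0 d1] := d01.
have [L1 ratio] := star_path_ratio_le delta d01.
near=> n => m.
have n1 : (0 < n)%N by near: n; exact: nbhs_infty_gt.
have LL1 : L1 <= ln n%:R by near: n; exact: near_ln_ge.
have LL2 : (4 / e) / (delta / 2) <= ln n%:R by near: n; exact: near_ln_ge.
set L := ln n%:R in LL1 LL2 * => fm.
have nL : n%:R = expR L by rewrite lnK // posrE ltr0n.
have sizes : tree_size (star_tree m) = tree_size (path_tree m.+1).
  by rewrite star_tree_size path_tree_size.
have an : 0 <= a n by exact: tree_sum_ge0.
apply: le_trans (sum_containing_le p p_gt0 _ _ n sizes n1) _.
rewrite ler_wpM2r //.
apply: (@le_trans _ _ (4 * n%:R * expR (- ((1 + delta / 2) * L)))).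
  by rewrite ler_wpM2l ?mulr_ge0 // ratio.
rewrite -mulrA nL -expRD.
have -> : L - (1 + delta / 2) * L = - (delta / 2 * L) by ring.
rewrite expRN ler_pdivrMr ?expR_gt0 // [leRHS]mulrC -ler_pdivrMr //.
have : 4 / e <= delta / 2 * L by rewrite [leRHS]mulrC -ler_pdivrMr //; lra.
by have := expR_ge1Dx (delta / 2 * L); lra.
Unshelve. all: by end_near. Qed.

End weight_estimates.

(** * Containment of all small trees *)

Section containment_laws.
Context {R : realType} {d0 d : measure_display} {Omega0 : measurableType d0}
  {P0 : probability Omega0 R} {Omega : measurableType d} {P : probability Omega R}.
Variables (xi : {RV P0 >-> nat}) (X : seq nat -> {RV P >-> nat}) (f : R -> R).
Hypothesis xi_mean : ('E_P0[fun w => (xi w)%:R] = 1)%E.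
Hypothesis xi_variance : (0 < 'V_P0[fun w => (xi w)%:R] < +oo)%E.
Hypothesis X_iid : iid_copies X xi.
Hypothesis xi_tail : super_exponential_tail f (nat_pmf xi).
Hypothesis f_bij : set_bij `[0, +oo[ `[0, +oo[ f.

Local Notation p := (nat_pmf xi).
Local Notation W := (gw_weight p).
Local Notation a := (tree_sum W).
Local Notation g := (nonneg_inverse f).

Let p_gt0 i : 0 < p i. Proof. by case: xi_tail. Qed.
Let f_ratio (x y : R) : 0 < x -> x <= y -> f x / x <= f y / y.
Proof. by case: xi_tail => _ _ _ _ [+ _]; apply. Qed.
Let W_ge0 := gw_weight_ge0 p p_gt0.
Let sum_p_le1 := pmf_partial_sum_le1 p p_gt0 (nat_pmf_total xi).
Let f_ge0 (x : R) : 0 <= x -> 0 <= f x.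
Proof. by case: xi_tail => _ _ _ + _; apply. Qed.

(** Every tree has positive probability, as all offspring probabilities are
    positive. *)
Lemma small_treesE k : small_trees X k = [set t | (tree_size t <= k)%N].
Proof.
apply/seteqP; split=> t /= [] // tk; split => //.
by rewrite (gw_event1_prob X xi X_iid) lte_fin gw_weight_gt0.
Qed.

(** A smaller tree is a fringe subtree of a tree of size k: lengthen it by a path
    above its root. *)
Lemma contains_all_of_size k t : (0 < k)%N ->
  (forall T, tree_size T = k -> T \in fringe_subtrees t) -> contains_all X k t.
Proof.
move=> k0 allk T; rewrite small_treesE /= => Tk.
apply: (fringe_trans t (unary_over (k - tree_size T) T)).
  by apply: allk; rewrite unary_over_size subnK.
exact: fringe_unary_over.
Qed.

Lemma contains_all_mem k t T : contains_all X k t -> (tree_size T <= k)%N ->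
  T \in fringe_subtrees t.
Proof. by move=> tk Tk; apply: tk; rewrite small_treesE. Qed.

Lemma contains_all_anti j k t : (j <= k)%N -> contains_all X k t -> contains_all X j t.
Proof.
move=> jk tk T; rewrite small_treesE /= => Tj.
exact: contains_all_mem tk (leq_trans Tj jk).
Qed.

(** The maximum exists: k = 0 qualifies, and a tree that contains a path of size
    k has at least k nodes. *)
Lemma max_containmentP t : contains_all X (max_containment X t) t /\
  forall j, contains_all X j t -> (j <= max_containment X t)%N.
Proof.
apply: (@xgetPex _ 0%N
  [set k | contains_all X k t /\ forall j, contains_all X j t -> (j <= k)%N]).
have ex0 : exists k, `[< contains_all X k t >].
  exists 0%N; apply/asboolP => T; rewrite small_treesE /= leqn0 => T0.
  by have := tree_size_gt0 T; rewrite (eqP T0).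
have bounded k : `[< contains_all X k t >] -> (k <= tree_size t)%N.
  move/asboolP; case: k => // k tk.
  rewrite -[leqLHS](path_tree_size k.+1) //; apply: fringe_tree_size.
  by apply: contains_all_mem tk _; rewrite path_tree_size.
case: (ex_maxnP ex0 bounded) => k /asboolP tk kmax.
by exists k; split => // j tj; apply: kmax; apply/asboolP.
Qed.

Lemma cond_gw_prob_le n e (A : set plane_tree) (b : pred plane_tree) : (0 < n)%N ->
  (forall t, tree_size t = n -> A t -> b t) ->
  \sum_(t <- trees n | b t) W t <= e * a n -> cond_gw_prob X n A <= e.
Proof.
move=> n0 Ab; rewrite (cond_gw_probE X xi X_iid) ler_pdivrMr ?tree_sum_gt0 //.
apply: le_trans; rewrite [leLHS]big_mkcond [leRHS]big_mkcond !big_seq.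
apply: ler_sum => t; rewrite mem_trees => /eqP tn.
case: asboolP => [/(Ab t tn) ->//|_]; by case: ifP.
Qed.

Lemma cond_gw_prob_ge0 n A : 0 <= cond_gw_prob X n A.
Proof.
rewrite (cond_gw_probE X xi X_iid) divr_ge0 ?sumr_ge0 //; exact: tree_sum_ge0.
Qed.

Lemma cond_gw_probC n A : (0 < n)%N ->
  cond_gw_prob X n (~` A) = 1 - cond_gw_prob X n A.
Proof.
move=> n0; have an : a n != 0 by rewrite gt_eqF // tree_sum_gt0.
rewrite !(cond_gw_probE X xi X_iid) -{1}(divff an) -mulrBl; congr (_ / _).
apply/eqP; rewrite eq_sym subr_eq eq_sym; apply/eqP.
rewrite [RHS](bigID (fun t => `[< A t >])) /= addrC; congr (_ + _).
by apply: eq_bigl => t; apply/asboolP/negP => /= [nA /asboolP//|nA At]; apply/nA/asboolP.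
Qed.

Lemma cond_gw_prob_leU n A B C : (forall t, tree_size t = n -> A t -> B t \/ C t) ->
  cond_gw_prob X n A <= cond_gw_prob X n B + cond_gw_prob X n C.
Proof.
move=> ABC; rewrite !(cond_gw_probE X xi X_iid) -mulrDl.
apply: ler_wpM2r; first by rewrite invr_ge0; exact: tree_sum_ge0.
rewrite big_mkcond [X in _ <= X + _]big_mkcond [X in _ <= _ + X]big_mkcond.
rewrite -big_split /= big_seq [leRHS]big_seq; apply: ler_sum => t.
rewrite mem_trees => /eqP tn.
have [At|_] := asboolP (A t); last by rewrite addr_ge0 //; case: ifP.
case: (ABC t tn At) => [/asboolT ->|/asboolT ->]; rewrite ?lerDl ?lerDr; by case: ifP.
Qed.

Lemma cond_gw_prob_cvg0 (A : nat -> set plane_tree) :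
  (forall e, 0 < e -> \forall n \near \oo, cond_gw_prob X n (A n) <= e) ->
  cond_gw_prob X n (A n) @[n --> \oo] --> (0 : R).
Proof.
move=> small; apply/cvgrPdist_le => e e0; near=> n.
rewrite sub0r normrN ger0_norm ?cond_gw_prob_ge0 //.
by near: n; exact: small.
Unshelve. all: by end_near. Qed.

Lemma cond_gw_prob_cvg1 (A : nat -> set plane_tree) :
  (forall e, 0 < e -> \forall n \near \oo, cond_gw_prob X n (~` A n) <= e) ->
  cond_gw_prob X n (A n) @[n --> \oo] --> (1 : R).
Proof.
move=> small; apply/cvgrPdist_le => e e0; near=> n.
rewrite -cond_gw_probC; last by near: n; exact: nbhs_infty_gt.
rewrite ger0_norm ?cond_gw_prob_ge0 //.
by near: n; exact: small.
Unshelve. all: by end_near. Qed.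

Lemma near_contains_all delta e : 0 < delta < 1 -> 0 < e ->
  \forall n \near \oo, forall k, (0 < k)%N ->
    k.-1%:R <= g ((1 - delta) * ln n%:R) ->
    cond_gw_prob X n (~` contains_all X k) <= e.
Proof.
move=> d01 e0; have [v mom2] := nat_pmf_second_moment xi xi_mean (andP xi_variance).2.
have lower := tree_sum_lower_bound p p_gt0 (nat_pmf_total xi)
  (nat_pmf_mean xi xi_mean) v mom2.
have := sum_missing_negligible p f p_gt0 sum_p_le1 xi_tail f_bij delta e d01 e0 lower.
move=> missing; near=> n => k k0 kg.
have n1 : (0 < n)%N by near: n; exact: nbhs_infty_gt.
have L0 : 0 <= ln n%:R :> R by near: n; exact: near_ln_ge.
have /andP[_ d1] := d01.
have fk : f k.-1%:R <= (1 - delta) * ln n%:R.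
  by rewrite -(le_nonneg_inverse f f_bij f_ratio) // mulr_ge0 //; lra.
apply: (cond_gw_prob_le n e _
  (fun t => has (fun T => T \notin fringe_subtrees t) (trees k)) n1); last first.
  move: (k) k0 fk {kg}; near: n; exact: missing.
move=> t _ /= nt; apply/negPn/negP => /hasPn allk; apply: nt.
apply: contains_all_of_size => // T Tk.
by apply/negPn/allk; rewrite mem_trees Tk.
Unshelve. all: by end_near. Qed.

Lemma near_misses_star delta e : 0 < delta <= 1 -> 0 < e ->
  \forall n \near \oo, forall k, (0 < k)%N ->
    g ((1 + delta) * ln n%:R) <= k.-1%:R ->
    cond_gw_prob X n (contains_all X k) <= e.
Proof.
move=> d01 e0.
have star := sum_star_negligible p f p_gt0 sum_p_le1 xi_tail f_bij delta e d01 e0.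
near=> n => k k0 kg.
have n1 : (0 < n)%N by near: n; exact: nbhs_infty_gt.
have L0 : 0 <= ln n%:R :> R by near: n; exact: near_ln_ge.
have /andP[delta0 _] := d01.
have fk : (1 + delta) * ln n%:R <= f k.-1%:R.
  by rewrite -(nonneg_inverse_le f f_bij f_ratio) // mulr_ge0 //; lra.
apply: (cond_gw_prob_le n e _
  (fun t => star_tree k.-1 \in fringe_subtrees t) n1); last first.
  move: (k.-1) fk {kg}; near: n; exact: star.
move=> t _ tk; apply: contains_all_mem tk _.
by rewrite star_tree_size prednK.
Unshelve. all: by end_near. Qed.

Lemma near_nonneg_inverse_ge M : \forall n \near \oo, M <= g (ln n%:R).
Proof.
near=> n; apply: (@le_trans _ _ (Num.max M 0)); first by rewrite le_max lexx.
have M0 : 0 <= Num.max M 0 by rewrite le_max lexx orbT.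
have L0 : 0 <= ln n%:R :> R by near: n; exact: near_ln_ge.
by rewrite (le_nonneg_inverse f f_bij f_ratio) //; near: n; exact: near_ln_ge.
Unshelve. all: by end_near. Qed.

(** If K_n deviates from G = g (log n) by more than eps * G, then some tree of
    size k1, just above (1 - lo) G, is missing, or all trees up to size k2, just
    above (1 + hi) G + 1, are present. As f (c x) <= c f x for c <= 1, these sizes
    lie on the right sides of g ((1 - lo) log n) and g ((1 + hi) log n). *)
Lemma max_containment_concentrates eps e : 0 < eps -> 0 < e ->
  \forall n \near \oo, cond_gw_prob X n
    [set t | `|(max_containment X t)%:R / g (ln n%:R) - 1| > eps] <= e.
Proof.
move=> eps0 e0; have e2 : 0 < e / 2 by lra.
pose lo := Num.min eps (1 / 2); pose hi := Num.min (eps / 2) 1.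
have lo01 : 0 < lo < 1 by rewrite lt_min gt_min; lra.
have hi01 : 0 < hi <= 1 by rewrite lt_min ge_min; lra.
have loe : lo <= eps by rewrite ge_min lexx.
have hie : hi <= eps / 2 by rewrite ge_min lexx.
near=> n.
have L0 : 0 <= ln n%:R :> R by near: n; exact: near_ln_ge.
have below : forall k, (0 < k)%N -> k.-1%:R <= g ((1 - lo) * ln n%:R) ->
    cond_gw_prob X n (~` contains_all X k) <= e / 2.
  by near: n; exact: near_contains_all.
have above : forall k, (0 < k)%N -> g ((1 + hi) * ln n%:R) <= k.-1%:R ->
    cond_gw_prob X n (contains_all X k) <= e / 2.
  by near: n; exact: near_misses_star.
have gbig : 2 / eps + 1 <= g (ln n%:R) by near: n; exact: near_nonneg_inverse_ge.
have eps2 : 0 < 2 / eps by rewrite divr_gt0.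
have fg : f (g (ln n%:R)) = ln n%:R by exact: nonneg_inverseK.
move: (g (ln n%:R)) gbig fg => G gbig fg.
have geps : 1 <= G * (eps / 2).
  have : 2 / eps * (eps / 2) <= G * (eps / 2) by rewrite ler_wpM2r //; lra.
  by rewrite (_ : 2 / eps * (eps / 2) = 1) //; field; lra.
have G0 : 0 < G by lra.
pose k1 := (Num.trunc ((1 - lo) * G)).+1; pose k2 := (Num.trunc ((1 + hi) * G)).+2.
have loG : 0 <= (1 - lo) * G by rewrite mulr_ge0 //; lra.
have hiG : 0 <= (1 + hi) * G by rewrite mulr_ge0 //; lra.
have p1 : cond_gw_prob X n (~` contains_all X k1) <= e / 2.
  apply: below => //=; apply: (@le_trans _ _ ((1 - lo) * G)).
    by rewrite truncn_le.
  rewrite (le_nonneg_inverse f f_bij f_ratio) //; last by rewrite mulr_ge0 //; lra.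
  by rewrite -fg; apply: (superlinear_contract f f_bij f_ratio); lra.
have p2 : cond_gw_prob X n (contains_all X k2) <= e / 2.
  apply: above => //=; apply: (@le_trans _ _ ((1 + hi) * G)); last first.
    exact/ltW/truncnS_gt.
  rewrite (nonneg_inverse_le f f_bij f_ratio) //; last by rewrite mulr_ge0 //; lra.
  have c01 : 0 <= (1 + hi)^-1 <= 1.
    by rewrite invr_ge0 invf_le1; lra.
  have := superlinear_contract f f_bij f_ratio _ _ c01 hiG.
  by rewrite mulKf ?fg ?ler_pdivlMl ?gt_eqF //; lra.
apply: (@le_trans _ _ (e / 2 + e / 2)); last by lra.
apply: le_trans (lerD p1 p2); apply: cond_gw_prob_leU => t _ /= far.
have [tk1|] := pselect (contains_all X k1 t); last by left.
have [tk2|ntk2] := pselect (contains_all X k2 t); [by right | exfalso].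
have [tK Kmax] := max_containmentP t; set K := max_containment X t in far tK Kmax.
have K1 : (k1 <= K)%N by exact: Kmax.
have K2 : (K < k2)%N.
  by rewrite ltnNge; apply/negP => k2K; apply: ntk2; exact: contains_all_anti k2K tK.
have K1R : (1 - lo) * G <= K%:R.
  by apply: (@le_trans _ _ k1%:R); rewrite ?ler_nat //; exact/ltW/truncnS_gt.
have K2R : K%:R <= (1 + hi) * G + 1.
  apply: (@le_trans _ _ ((Num.trunc ((1 + hi) * G)).+1%:R)); first by rewrite ler_nat.
  by rewrite -natr1 lerD2r truncn_le.
move: far; rewrite ltNge => /negP; apply.
have -> : K%:R / G - 1 = (K%:R - G) / G by field; rewrite gt_eqF.
rewrite normrM normfV (gtr0_norm G0) ler_pdivrMr // ler_norml; apply/andP; split.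
  have : lo * G <= eps * G by rewrite ler_wpM2r // ltW.
  by lra.
have : hi * G <= eps / 2 * G by rewrite ler_wpM2r // ltW.
by lra.
Unshelve. all: by end_near. Qed.

End containment_laws.

Theorem theorem8 (R : realType)
  (d0 : measure_display) (Omega0 : measurableType d0)
  (P0 : probability Omega0 R) (xi : {RV P0 >-> nat})
  (d : measure_display) (Omega : measurableType d)
  (P : probability Omega R) (X : seq nat -> {RV P >-> nat})
  (f : R -> R) :
  ('E_P0[fun w => (xi w)%:R] = 1)%E ->
  (0 < 'V_P0[fun w => (xi w)%:R] < +oo)%E ->
  iid_copies X xi ->
  super_exponential_tail f (nat_pmf xi) ->
  set_bij `[0, +oo[ `[0, +oo[ f ->
  (forall k : nat -> nat, (forall n, (0 < k n)%N) ->
   forall delta : R, 0 < delta ->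
     ((forall n, (0 < n)%N ->
         (k n)%:R <= nonneg_inverse f ((1 - delta) * ln n%:R) + 1) ->
      cond_gw_prob X n (contains_all X (k n)) @[n --> \oo] --> (1 : R)) /\
     ((forall n, (0 < n)%N ->
         (k n)%:R >= nonneg_inverse f ((1 + delta) * ln n%:R) + 1) ->
      cond_gw_prob X n (~` contains_all X (k n)) @[n --> \oo] --> (1 : R))) /\
  (forall eps : R, 0 < eps ->
     cond_gw_prob X n
       [set t | `|(max_containment X t)%:R / nonneg_inverse f (ln n%:R) - 1| > eps]
     @[n --> \oo] --> (0 : R)).
Proof.
move=> xi_mean xi_variance X_iid xi_tail f_bij.
have f_ratio (x y : R) : 0 < x -> x <= y -> f x / x <= f y / y.
  by case: xi_tail => _ _ _ _ [+ _]; apply.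
have homo := nonneg_inverse_homo f f_bij f_ratio.
split=> [k k0 delta delta0|eps eps0]; last first.
  apply: (cond_gw_prob_cvg0 xi X f) => // e e0.
  exact: (max_containment_concentrates xi X f).
have predk n : (k n).-1%:R = (k n)%:R - 1 :> R.
  by rewrite -[in RHS](prednK (k0 n)) -natr1 addrK.
split=> kn.
  apply: (cond_gw_prob_cvg1 xi X f) => // e e0.
  pose del := Num.min delta (1 / 2).
  have d01 : 0 < del < 1 by rewrite lt_min gt_min; lra.
  have dd : del <= delta by rewrite ge_min lexx.
  near=> n.
  have n1 : (0 < n)%N by near: n; exact: nbhs_infty_gt.
  have L0 : 0 <= ln n%:R :> R by near: n; exact: near_ln_ge.
  have kdel : (k n).-1%:R <= nonneg_inverse f ((1 - del) * ln n%:R).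
    rewrite predk lerBlDr; apply: le_trans (kn n n1) _.
    by rewrite lerD2r; apply: homo; rewrite ler_wpM2r //; lra.
  move: (k n) (k0 n) kdel; near: n; exact: (near_contains_all xi X f).
apply: (cond_gw_prob_cvg1 xi X f) => // e e0.
pose del := Num.min delta 1.
have d01 : 0 < del <= 1 by rewrite lt_min ge_min; lra.
have dd : del <= delta by rewrite ge_min lexx.
near=> n.
have n1 : (0 < n)%N by near: n; exact: nbhs_infty_gt.
have L0 : 0 <= ln n%:R :> R by near: n; exact: near_ln_ge.
have kdel : nonneg_inverse f ((1 + del) * ln n%:R) <= (k n).-1%:R.
  rewrite predk lerBrDr; apply: le_trans (kn n n1).
  by rewrite lerD2r; apply: homo; rewrite ler_wpM2r //; lra.
rewrite setCK; move: (k n) (k0 n) kdel; near: n; exact: (near_misses_star xi X f).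
Unshelve. all: by end_near. Qed.
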